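(* Let $y,p,r$ be integers with $y\ge 2$, $p\ge y$ and $r\ge 0$. Then there is a curve in $H_{r,y,p}(2H)$ specializing to one in $H_{r+p-y,\,y-1,\,p+1}(2H)$.
   Context: $k$ is an algebraically closed field. A curve is a purely one-dimensional locally Cohen-Macaulay (i.e. without embedded points) closed subscheme of $\mathbb{P}^3=\mathbb{P}^3_k$. $H\subset\mathbb{P}^3$ is a plane with equation $h=0$, and $2H$ is the scheme defined by $h^2=0$. The triple $T(C)=\{Z,Y,P\}$ associated to a curve $C\subset 2H$ is defined as follows: one writes $\mathcal{I}_{C\cap H,H}=\mathcal{I}_{Z,H}(-P)$ with $P\subset H$ a curve (effective Cartier divisor) and $Z\subset H$ zero-dimensional (possibly empty); and $Y\subset H$ is the residual scheme to the intersection of $C$ with $H$, i.e. $\mathcal{I}_Y=(\mathcal{I}_C:\mathcal{I}_H)$. $H_{z,y,p}(2H)$ denotes the family (a locally closed subscheme of the Hilbert scheme of curves in $2H$) of curves $C\subset 2H$ such that $Z$ has length $z$ and $Y,P$ have degrees $y,p$. ''A curve in $H_{r,y,p}(2H)$ specializing to one in $H_{r',y',p'}(2H)$'' means: there is a family of curves in $2H$, flat over an irreducible nonsingular pointed curve $(T,0)$, whose fibres over $t\ne0$ belong to $H_{r,y,p}(2H)$ and whose fibre over $0$ belongs to $H_{r',y',p'}(2H)$. *)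

(* Defs.v *)
From HB Require Import structures.
From mathcomp Require Import all_boot all_order all_algebra.
From mathcomp Require Import mpoly.

Set Implicit Arguments.
Unset Strict Implicit.
Unset Printing Implicit Defensive.

Import GRing.Theory.
Local Open Scope ring_scope.

(* Ideals are Prop-valued predicates and are compared extensionally.          *)

Section Ideals.
Variable R : comNzRingType.
Implicit Types I J : R -> Prop.

Definition sub_id I J := forall x, I x -> J x.
Definition eq_id I J := forall x, I x <-> J x.

Definition is_ideal I :=
  [/\ I 0, forall a b, I a -> I b -> I (a + b) & forall a b, I b -> I (a * b)].

Definition is_prime I :=
  [/\ is_ideal I, ~ I 1 & forall a b, I (a * b) -> I a \/ I b].

Definition is_maximal I :=
  [/\ is_ideal I, ~ I 1 &
      forall J, is_ideal J -> sub_id I J -> ~ J 1 -> sub_id J I].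

Definition gen_id (G : R -> Prop) : R -> Prop :=
  fun x => forall J, is_ideal J -> sub_id G J -> J x.

Definition principal (f : R) : R -> Prop := fun x => exists a, x = a * f.

Definition add_id I J : R -> Prop :=
  fun x => exists a b, [/\ I a, J b & x = a + b].

Definition mul_id I J : R -> Prop :=
  gen_id (fun x => exists a b, [/\ I a, J b & x = a * b]).

Definition colon_id I J : R -> Prop := fun x => forall a, J a -> I (a * x).

End Ideals.

(* A closed subscheme of P^3_A is represented by its saturated homogeneous    *)
(* ideal in A[X_0,...,X_3]; every closed subscheme has exactly one such ideal *)
(* (A is an arbitrary commutative ring here).                                 *)

Section ProjectiveSpace.
Variable A : comNzRingType.
Local Notation S := {mpoly A[4]}.
Implicit Types I J Q : S -> Prop.

Definition homogeneous I :=
  is_ideal I /\ forall d f, I f -> I (pihomog mdeg d f).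

Definition saturation I : S -> Prop :=
  fun f => exists n, forall m : 'X_{1..4}, mdeg m = n -> I ('X_[m] * f).

Definition closed_subscheme I :=
  homogeneous I /\ sub_id (saturation I) I.

(* A (not necessarily closed) point of Proj A[X_0,...,X_3]. *)
Definition is_point Q :=
  [/\ homogeneous Q, is_prime Q & exists i : 'I_4, ~ Q 'X_i].

(* There is a strict chain Q < Q_1 < ... < Q_n of points. *)
Fixpoint chain_above Q (n : nat) : Prop :=
  if n is n'.+1 then
    exists Q', [/\ is_point Q', sub_id Q Q', ~ sub_id Q' Q & chain_above Q' n']
  else True.

(* The closure of the point Q has dimension n. *)
Definition point_dim Q n := chain_above Q n /\ ~ chain_above Q n.+1.

(* Q is the generic point of an irreducible component of V(I). *)
Definition is_component I Q :=
  [/\ is_point Q, sub_id I Q &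
      forall Q', is_point Q' -> sub_id I Q' -> sub_id Q' Q -> sub_id Q Q'].

Definition is_associated I Q :=
  is_point Q /\ exists f, eq_id Q (colon_id I (principal f)).

Definition no_embedded_points I :=
  forall Q, is_associated I Q -> is_component I Q.

Definition is_curve I :=
  [/\ closed_subscheme I, ~ I 1,
      forall Q, is_component I Q -> point_dim Q 1 & no_embedded_points I].

(* The empty scheme is allowed. *)
Definition zero_dimensional I :=
  closed_subscheme I /\
  forall Q, is_point Q -> sub_id I Q -> point_dim Q 0.

(* The ideal of the chart {X_i <> 0}, identified with {X_i = 1}. *)
Definition chart_ideal I (i : 'I_4) : S -> Prop :=
  add_id I (principal ('X_i - 1)).

End ProjectiveSpace.

Section Degrees.
Variable k : fieldType.
Local Notation S := {mpoly k[4]}.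
Implicit Types I : S -> Prop.

(* dim_k (S/I)_n = d: the classes of some b_1, ..., b_d form a basis. *)
Definition hilbert_function I (n d : nat) :=
  exists b : 'I_d -> S, (forall i, b i \is n.-homog) /\
    forall f : S, f \is n.-homog ->
      exists! c : {ffun 'I_d -> k}, I (f - \sum_i c i *: b i).

Definition hilbert_polynomial I (P : {poly rat}) :=
  exists N : nat, forall n : nat, (N <= n)%N ->
    exists2 d : nat, hilbert_function I n d & P.[n%:R] = d%:R.

Definition has_degree I (d : nat) :=
  exists c : rat, hilbert_polynomial I (d%:R *: 'X + c%:P).

(* Length of a zero-dimensional subscheme: z = h^0(O_Z) is the value of its   *)
(* constant Hilbert polynomial.                                               *)
Definition has_length I (z : nat) := hilbert_polynomial I (z%:R)%:P.

End Degrees.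

Section DoublePlane.
Variables (k : fieldType) (h : {mpoly k[4]}).
Local Notation S := {mpoly k[4]}.

(* T(C) = {Z, Y, P} with P the divisor f = 0 of H. The equality               *)
(* I_{C cap H, H} = I_{Z,H}(-P) is written with saturated ideals of S         *)
(* containing h.                                                              *)
Definition is_triple (C Z Y : S -> Prop) (f : S) :=
  [/\ [/\ zero_dimensional Z & Z h],
      (exists d, f \is d.-homog) /\ ~ principal h f,
      eq_id (saturation (add_id C (principal h)))
            (add_id (mul_id (principal f) Z) (principal h)) &
      eq_id Y (colon_id C (principal h))].

Definition in_Hzyp (z y p : nat) (C : S -> Prop) :=
  [/\ is_curve C, C (h ^+ 2) &
      exists (Z Y : S -> Prop) (f : S),
        [/\ is_triple C Z Y f, has_length Z z, has_degree Y y &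
            has_degree (add_id (principal f) (principal h)) p]].

End DoublePlane.

Section Flatness.
Variables (A : comNzRingType) (M : lmodType A).

(* The element sum_i n_i (x) [m_i] of N (x)_A (M/J), J a submodule of M,      *)
(* vanishes; by the universal property of the tensor product, this means that *)
(* every bilinear map out of N x (M/J) kills it.                              *)
Definition tensor_zero (J : M -> Prop) (N : lmodType A) (s : seq (N * M)) :=
  forall (L : lmodType A) (b : N -> M -> L),
    (forall n, linear (b n)) -> (forall m, linear (b^~ m)) ->
    (forall n m, J m -> b n m = 0) ->
    \sum_(u <- s) b u.1 u.2 = 0.

(* M/J is a flat A-module: (-) (x)_A (M/J) preserves injectivity. *)
Definition flat_quotient (J : M -> Prop) :=
  forall (N' N : lmodType A) (g : {linear N' -> N}), injective g ->
  forall s : seq (N' * M),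
    tensor_zero J [seq (g u.1, u.2) | u <- s] -> tensor_zero J s.

End Flatness.

Section Families.
Variables (k : fieldType) (A : idomainType) (phi : {rmorphism k -> A}).

Definition finitely_generated_algebra :=
  exists (n : nat) (a : 'I_n -> A), forall x, exists P : {mpoly k[n]},
    x = mmap phi a P.

Definition dimension_one :=
  (exists P, is_prime P /\ exists2 a : A, P a & a <> 0) /\
  (forall P : A -> Prop, is_prime P -> (exists2 a, P a & a <> 0) ->
     is_maximal P).

(* Every m/m^2 is one-dimensional over A/m, i.e. all local rings at closed    *)
(* points are regular (when dim A = 1).                                       *)
Definition nonsingular :=
  forall P : A -> Prop, is_maximal P ->
    exists u, [/\ P u, ~ mul_id P P u &
      forall a, P a -> exists c, mul_id P P (a - c * u)].

(* T = Spec A is an irreducible nonsingular affine curve over k. *)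
Definition nonsingular_affine_curve :=
  [/\ finitely_generated_algebra, dimension_one & nonsingular].

Definition closed_point (t : {rmorphism A -> k}) := cancel phi t.

(* The family over Spec A defined by I is flat: so are its four charts. *)
Definition flat_family (I : {mpoly A[4]} -> Prop) :=
  closed_subscheme I /\ forall i, flat_quotient (chart_ideal I i).

Definition fibre (I : {mpoly A[4]} -> Prop) (t : {rmorphism A -> k}) :
    {mpoly k[4]} -> Prop :=
  saturation (fun f => exists2 g, I g & f = map_mpoly t g).

End Families.

(* Some curve in H_{z,y,p}(2H) specializes to one in H_{z',y',p'}(2H).        *)
(* Shrinking T around 0, one may take T affine.                               *)
Definition specializes (k : fieldType) (h : {mpoly k[4]})
    (z y p z' y' p' : nat) :=
  exists (A : idomainType) (phi : {rmorphism k -> A})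
         (t0 : {rmorphism A -> k}) (I : {mpoly A[4]} -> Prop),
    [/\ nonsingular_affine_curve phi /\ closed_point phi t0,
        flat_family I /\ I (map_mpoly phi h ^+ 2),
        forall t : {rmorphism A -> k}, closed_point phi t -> ~ t =1 t0 ->
          in_Hzyp h z y p (fibre I t) &
        in_Hzyp h z' y' p' (fibre I t0)].

(* Main.v *)
Require Import Defs.
From HB Require Import structures.
From mathcomp Require Import all_boot all_order all_algebra.
From mathcomp Require Import boolp functions.
From mathcomp Require Import mpoly generic_quotient ring_quotient.
From mathcomp Require Import zify ring.

Set Implicit Arguments.
Unset Strict Implicit.
Unset Printing Implicit Defensive.

Import GRing.Theory.
Local Open Scope ring_scope.

(* Choose linear coordinates h, x, v, w and put m = p - y, n = m + r,         *)
(* N = 2m + 2 + r. A form F = a + h b mod h^2 has coefficients a_i, b_i in    *)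
(* k[v, w] of x^i. For t in k let C_t be the subscheme of 2H defined by       *)
(*   b_i = 0 (i < y - 2),  a_i = 0 (i < p),  w^(m+1) a_p + t b_(y-2) = 0,     *)
(*   w^N a_(p+1) + v^n b_(y-2) + t w^(m+1+r) b_(y-1) = 0.                     *)
(* These equations are linear over the domain k[v, w], so the ideal is        *)
(* primary to the line h = x = 0: C_t is a multiple structure on a line       *)
(* without embedded points. For t <> 0 its triple is Z = (h, x, w^r),         *)
(* Y = (h, x^y), P = (h, x^p); at t = 0 the third equation degenerates to     *)
(* a_p = 0 and the triple becomes Z = (h, x, v^n), Y = (h, x^(y-1)),          *)
(* P = (h, x^(p+1)). Over A = k[t] the same equations define a saturated      *)
(* ideal whose graded pieces have A-free quotients, which gives flatness, and *)
(* its fibres are the C_t since w^N F and v^n F lift to the ideal for every F *)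
(* in the ideal of C_t.                                                       *)

(** The degeneration comes from the equation w^(m+1) a_p + t b_(y-2) = 0. For t nonzero it
    determines b_(y-2) from a_p, so a_p survives subject to a divisibility condition, and no element
    of the ideal of the form h F involves x^(y-2) in F modulo h. At t = 0 it kills a_p and frees
    b_(y-2), which the last equation then ties to a_(p+1) alone. One unit of degree thus passes from
    Y to P, and the condition w^r | a_p is replaced by v^(m+r) | a_(p+1), which gives the new length
    m + r = r + p - y.

    The exponents make the equations homogeneous and stable under multiplication by forms
    ([mul_low], [fam_ideal]). Working over the domain k[v, w] makes the ideal primary to the line
    ([fam_primary]), which yields saturation and, over an algebraically closed field, a curve
    without embedded points ([fam_curve]). The triples are read off in [in_Hzyp_fam_neq0] and
    [in_Hzyp_fam_eq0] by comparison with monomial ideals.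

    Over k[t] each graded piece of the coordinate ring embeds in a finite free module, hence is free
    ([dual_basis_functionals], [fam_dual_basis]), and graded pieces of this kind make every chart
    flat ([flat_chart]). The delicate point is that the fibre over a point, which is a saturation,
    is no larger and no smaller than the scheme given by the specialized equations ([fam_fibre]).
    Finally a linear change of coordinates carries the plane X_0 = 0 to h = 0
    ([linear_form_coordinate], [pull_in_Hzyp]). *)

(** Flatness is tested against bilinear maps into arbitrary modules. This supplies the target needed
    in [flat_chart], a quotient by a submodule given only as a proposition. *)
Lemma quotient_module (A : nzRingType) (V : lmodType A) (K : V -> Prop) :
    K 0 -> (forall a u v, K u -> K v -> K (a *: u + v)) ->
  exists (Q : lmodType A) (pi : V -> Q),
    linear pi /\ forall v, pi v = 0 <-> K v.
Proof.
move=> K0 Klin; pose P : {pred V} := fun v => `[< K v >].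
have closedP : zmod_closed P.
  split=> [|u v /asboolP Ku /asboolP Kv]; apply/asboolP => //.
  by rewrite addrC -scaleN1r; apply: Klin.
have closedZ a v : v \in P -> a *: v \in P.
  by move=> /asboolP Kv; apply/asboolP; rewrite -[_ *: _]addr0; apply: Klin.
pose SP : zmodClosed V := HB.pack P (GRing.isZmodClosed.Build V P closedP).
pose Q := Quotient.quot SP; pose pi : V -> Q := (\pi_Q)%qT.
have piE u v : (pi u = pi v) <-> (u - v \in P).
  have -> : (u - v \in P) = (u == v %[mod Q])%qT by exact: (Quotient.idealrBE SP).
  by split=> [/eqP|/eqP].
have piD : {morph pi : u v / u + v} by move=> u v; apply: (Quotient.pi_add SP).
pose scale a (q : Q) : Q := pi (a *: repr q).
have reprE q : pi (repr q) = q by exact: reprK.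
have pi_scale a v : scale a (pi v) = pi (a *: v).
  by apply/piE; rewrite -scalerBr closedZ //; apply/piE.
have scaleA a b q : scale a (scale b q) = scale (a * b) q.
  by rewrite -[q]reprE !pi_scale scalerA.
have scale1 : left_id 1 scale.
  by move=> q; rewrite -[q]reprE pi_scale scale1r.
have scaleDr : right_distributive scale +%R.
  by move=> a p q; rewrite -[p]reprE -[q]reprE -piD !pi_scale -piD scalerDr.
have scaleDl q : {morph scale^~ q : a b / a + b}.
  by move=> a b; rewrite -[q]reprE !pi_scale scalerDl piD.
pose M : lmodType A := HB.pack Q
  (GRing.Zmodule_isLmodule.Build A Q scaleA scale1 scaleDr scaleDl).
exists M, pi; split=> [a u v|v]; first by rewrite piD -pi_scale.
have pi0 : pi 0 = 0 by apply: (@addrI _ (pi 0)); rewrite -piD !addr0.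
by rewrite -[0 in X in X <-> _]pi0 piE subr0; split=> /asboolP.
Qed.

(** * Homogeneous parts and elementary ideal theory *)

Section Homogeneity.
Variables (n : nat) (R : nzRingType).
Implicit Types p q : {mpoly R[n]}.

Lemma mcoeff_pihomog d p m :
  (pihomog mdeg d p)@_m = if mdeg m == d then p@_m else 0.
Proof.
rewrite pihomogE raddf_sum /=; case: ifP => md; last first.
  rewrite big1_seq // => m' /andP[/eqP m'd _].
  rewrite mcoeffZ mcoeffX; case: eqP => [E|_]; last by rewrite mulr0.
  by rewrite -E m'd eqxx in md.
have [mp|mp] := boolP (m \in msupp p); last first.
  rewrite (memN_msupp_eq0 mp) big1_seq // => m' /andP[_ m'p].
  rewrite mcoeffZ mcoeffX; case: eqP => [E|_]; last by rewrite mulr0.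
  by rewrite -E m'p in mp.
rewrite big_mkcond (bigD1_seq m) ?msupp_uniq //= md mcoeffZ mcoeffX eqxx mulr1.
rewrite big1 ?addr0 // => m' ne; case: ifP => // _.
by rewrite mcoeffZ mcoeffX (negPf ne) mulr0.
Qed.

Lemma pihomog_sum_le p d : (msize p <= d.+1)%N ->
  p = \sum_(e < d.+1) pihomog mdeg e p.
Proof. exact: pihomog_partitionE. Qed.

Lemma pihomog_eq0 p d : (msize p <= d)%N -> pihomog mdeg d p = 0.
Proof.
move=> h; apply/mpolyP => m; rewrite mcoeff_pihomog mcoeff0.
case: eqP => // md; apply/memN_msupp_eq0/msize_mdeg_ge; by rewrite md.
Qed.

End Homogeneity.

Lemma mcoeff_XM (R : comNzRingType) n (i : 'I_n) (p : {mpoly R[n]}) m :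
  ('X_i * p)@_m = if (0 < m i)%N then p@_(m - U_(i)) else 0.
Proof.
case: ifP => mi.
  have E : m = (m - U_(i) + U_(i))%MM by rewrite submK // lep1mP -lt0n.
  by rewrite [in LHS]E mulrC addmC mcoeffMX.
apply/memN_msupp_eq0/negP => /msuppM_le /allpairsP[[m1 m2] /= [m1X _ E]].
move: m1X; rewrite msuppX inE => /eqP m1E; move: mi.
by rewrite E m1E mnmDE mnm1E eqxx.
Qed.

Lemma pihomog_XM (R : comNzRingType) n (i : 'I_n) (p : {mpoly R[n]}) d :
  pihomog mdeg d.+1 ('X_i * p) = 'X_i * pihomog mdeg d p.
Proof.
apply/mpolyP => m; rewrite mcoeff_pihomog !mcoeff_XM mcoeff_pihomog.
case: (ltnP 0 (m i)) => mi; last by rewrite if_same.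
have E : m = (m - U_(i) + U_(i))%MM by rewrite submK // lep1mP -lt0n.
by rewrite {1}E mdegD mdeg1 addn1 eqSS.
Qed.

Lemma pihomog0_XM (R : comNzRingType) n (i : 'I_n) (p : {mpoly R[n]}) :
  pihomog mdeg 0 ('X_i * p) = 0.
Proof.
apply/mpolyP => m; rewrite mcoeff_pihomog mcoeff_XM mcoeff0.
case: eqP => // /eqP; rewrite mdeg_eq0 => /eqP ->.
by rewrite mnm0E.
Qed.

Section IdealTheory.
Variable R : comNzRingType.
Implicit Types I J : R -> Prop.

Lemma ideal0 I : is_ideal I -> I 0. Proof. by case. Qed.

Lemma idealD I a b : is_ideal I -> I a -> I b -> I (a + b).
Proof. by case=> _ h _; apply: h. Qed.

Lemma idealM I a b : is_ideal I -> I b -> I (a * b).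
Proof. by case=> _ _ h; apply: h. Qed.

Lemma idealMr I a b : is_ideal I -> I a -> I (a * b).
Proof. by move=> h Ia; rewrite mulrC; apply: idealM. Qed.

Lemma idealN I a : is_ideal I -> I a -> I (- a).
Proof. by move=> h Ia; rewrite -mulN1r; apply: idealM. Qed.

Lemma idealB I a b : is_ideal I -> I a -> I b -> I (a - b).
Proof. by move=> h Ia Ib; apply: idealD => //; apply: idealN. Qed.

Lemma ideal_sum I (T : Type) (r : seq T) (P : pred T) (F : T -> R) :
  is_ideal I -> (forall i, P i -> I (F i)) -> I (\sum_(i <- r | P i) F i).
Proof.
move=> h hF; elim/big_ind: _ => //; first exact: ideal0.
by move=> x y; apply: idealD.
Qed.

Lemma principal_ideal (f : R) : is_ideal (principal f).
Proof.
split=> [|a b [c ->] [d ->]|a b [c ->]]; first by exists 0; rewrite mul0r.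
  by exists (c + d); rewrite mulrDl.
by exists (a * c); rewrite mulrA.
Qed.

Lemma add_ideal I J : is_ideal I -> is_ideal J -> is_ideal (add_id I J).
Proof.
move=> hI hJ; split=> [|a b [x [y [Ix Jy ->]]] [z [t [Iz Jt ->]]]|a b].
- by exists 0, 0; split; rewrite ?addr0 //; apply: ideal0.
- by exists (x + z), (y + t); split; [apply: idealD|apply: idealD|ring].
move=> [x [y [Ix Jy ->]]]; exists (a * x), (a * y).
by split; [apply: idealM|apply: idealM|rewrite mulrDr].
Qed.

Lemma add_idl I J x : is_ideal J -> I x -> add_id I J x.
Proof. by move=> hJ Ix; exists x, 0; split; rewrite ?addr0 //; apply: ideal0. Qed.

Lemma add_idr I J x : is_ideal I -> J x -> add_id I J x.
Proof. by move=> hI Jx; exists 0, x; split; rewrite ?add0r //; apply: ideal0. Qed.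

Lemma eq_idP I J : eq_id I J -> I = J.
Proof. by move=> h; apply/funext => x; apply/propext/h. Qed.

End IdealTheory.

(** * Flatness of graded families *)

Section ChartFlatness.
Variable A : comNzRingType.
Local Notation S := {mpoly A[4]}.
Implicit Types I : S -> Prop.

(** The dual basis criterion: the degree d part of S/I is finitely generated projective. The
    functionals live on all of S and kill I; they need not be biorthogonal to the [e i]. *)
Definition graded_dual_basis I d := exists (r : nat) (e : nat -> S)
    (la : nat -> S -> A),
  [/\ forall i a x y, la i (a *: x + y) = a * la i x + la i y,
      forall i x, I x -> la i x = 0 &
      forall x, x \is d.-homog -> I (x - \sum_(i < r) la i x *: e i)].

(** Parts of degree above d are dropped, which makes this a linear map on all of S. It is the usual
    homogenization with respect to X_i when f has degree at most d. *)
Definition homogenize (i : 'I_4) d (f : S) : S :=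
  \sum_(e < d.+1) 'X_i ^+ (d - e) * pihomog mdeg e f.

Lemma homogenize_linear i d : linear (homogenize i d).
Proof.
move=> a f g; rewrite /homogenize scaler_sumr -big_split /=.
by apply: eq_bigr => e _; rewrite linearP mulrDr scalerAr.
Qed.

Lemma homogenizeP i d f : homogenize i d f \is d.-homog.
Proof.
apply: rpred_sum => e _; have ed : (e <= d)%N by rewrite -ltnS.
have : 'X_i ^+ (d - e) * pihomog mdeg e f \is (d - e + e).-homog.
  apply: dhomogM; last exact: pihomogP.
  by rewrite mpolyXn dhomogX /= mdegMn mdeg1 mul1n.
by rewrite subnK.
Qed.

Lemma homogenize_ideal I i d f : homogeneous I -> I f -> I (homogenize i d f).
Proof.
by case=> hI hh If; apply: ideal_sum => // e _; apply: idealM => //; apply: hh.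
Qed.

(** Multiplying by X_i raises the degree of a part by one and lowers the compensating power of X_i
    by one, so the two sums agree after a shift of index. The bound says that f has degree below d,
    so no part of X_i f is dropped. *)
Lemma homogenize_dehomog i d (f : S) : (msize f <= d)%N ->
  homogenize i d (f * ('X_i - 1)) = 0.
Proof.
move=> fd; rewrite mulrBr mulr1 [f * _]mulrC.
rewrite -[_ - f]addrC -scaleN1r homogenize_linear scaleN1r.
rewrite /homogenize [X in - X]big_ord_recr /= pihomog_eq0 // mulr0 addr0.
rewrite big_ord_recl pihomog0_XM mulr0 add0r.
apply/eqP; rewrite addrC subr_eq0; apply/eqP/eq_bigr => e _.
rewrite lift0 pihomog_XM mulrA -exprSr; congr ('X_i ^+ _ * _).
by rewrite subnSK.
Qed.

Lemma sub_homogenize i d (f : S) : (msize f <= d.+1)%N ->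
  principal ('X_i - 1) (f - homogenize i d f).
Proof.
move=> fd; rewrite {1}(pihomog_sum_le fd) -sumrB.
have idP := principal_ideal ('X_i - 1 : S).
apply: (ideal_sum _ idP) => e _.
rewrite -{1}[pihomog _ _ _]mul1r -mulrBl mulrC; apply: (idealM _ idP).
have -> : 1 - 'X_i ^+ (d - e) = - ('X_i ^+ (d - e) - 1) :> S by rewrite opprB.
apply: (idealN idP).
by rewrite subrX1; exists (\sum_(j < d - e) 'X_i ^+ j); rewrite mulrC.
Qed.

(* S/I being free in each degree, N (x) (S/(I, X_i - 1)) is the direct limit  *)
(* of the modules N (x) (S/I)_d along multiplication by X_i. It is realised   *)
(* by sequences of coordinate vectors modulo eventual equality.               *)
Lemma flat_chart I i : homogeneous I -> (forall d, graded_dual_basis I d) ->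
  flat_quotient (chart_ideal I i).
Proof.
move=> hI basisI N' N g g_inj s gs0 L b b_linr b_linl bJ.
have idI : is_ideal I by case: hI.
have idP : is_ideal (principal ('X_i - 1 : S)) by exact: principal_ideal.
pose T := (nat * (nat -> S) * (nat -> S -> A))%type.
have /choice[D DP] : forall d, exists D : T,
    [/\ forall j a x y, D.2 j (a *: x + y) = a * D.2 j x + D.2 j y,
        forall j x, I x -> D.2 j x = 0 &
        forall x, x \is d.-homog ->
          I (x - \sum_(j < D.1.1) D.2 j x *: D.1.2 j)].
  by move=> d; have [r [e [la h]]] := basisI d; exists (r, e, la).
pose V := GRing.Lmodule.clone A (nat -> nat -> N) _.
(* Elements of V are sequences indexed by the degree d and the coordinate j; K consists of those
   that vanish for all large d. *)
pose K (u : V) := exists d0, forall d, (d0 <= d)%N -> forall j, u d j = 0.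
have [||Q [pi [pi_lin piK]]] := @quotient_module A V K.
- by exists 0%N.
- move=> a u v [d1 h1] [d2 h2]; exists (maxn d1 d2) => d.
  rewrite geq_max => /andP[/h1 u0 /h2 v0] j.
  by rewrite /= !fctE /= u0 v0 scaler0 addr0.
pose c d j m := (D d).2 j (homogenize i d m).
have c_lin d j a x y : c d j (a *: x + y) = a * c d j x + c d j y.
  by rewrite /c homogenize_linear; have [h _ _] := DP d; rewrite h.
(* The test map: n (x) m goes to the coordinates of the homogenizations of m, times n. It kills I
   because the functionals do, and multiples of X_i - 1 because their homogenizations vanish in
   large degree. *)
pose B (n : N) (m : S) : Q := pi (fun d j => c d j m *: n).
have pi0 : pi 0 = 0 by apply/piK; exists 0%N.
have piD : {morph pi : u v / u + v}.
  by move=> u v; rewrite -[u]scale1r pi_lin !scale1r.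
have gsE : \sum_(u <- [seq (g u.1, u.2) | u <- s]) B u.1 u.2 =
    pi (\sum_(u <- s) (fun d j => c d j u.2 *: g u.1 : N)).
  rewrite big_map; elim: (s) => [|u s' IHs]; rewrite ?big_nil ?pi0 //.
  by rewrite !big_cons IHs piD.
have /piK[d0 hd0] : pi (\sum_(u <- s) (fun d j => c d j u.2 *: g u.1 : N)) = 0.
  rewrite -gsE; apply: gs0.
  - move=> n a x y; rewrite -pi_lin; congr pi; apply/funext => d.
    by apply/funext => j; rewrite !fctE c_lin scalerDl scalerA.
  - move=> m a x y; rewrite -pi_lin; congr pi; apply/funext => d.
    by apply/funext => j; rewrite !fctE scalerDr !scalerA mulrC.
  - move=> n m [x [y [Ix [z ->] ->]]]; apply/piK; exists (msize z) => d zd j.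
    have [h1 h2 _] := DP d; rewrite /c.
    rewrite -[x]scale1r homogenize_linear homogenize_dehomog // addr0 scale1r.
    by rewrite h2 ?scale0r //; apply: homogenize_ideal.
(* One degree large enough both for the relation obtained from B and for every polynomial occurring
   in s. *)
pose d := maxn d0 (\max_(u <- s) msize u.2).
have sd u : u \in s -> (msize u.2 <= d.+1)%N.
  move=> us; apply/leqW; rewrite leq_max; apply/orP; right.
  exact: (leq_bigmax_seq _ us).
have c0 j : \sum_(u <- s) c d j u.2 *: u.1 = 0.
  apply: g_inj; rewrite raddf0 raddf_sum -[RHS](hd0 d (leq_maxl _ _) j).
  elim: (s) => [|u s' IHs]; rewrite ?big_nil // !big_cons !fctE -IHs.
  by congr (_ + _); apply: linearZ_LR.
have b0 n : b n 0 = 0 by apply: bJ; apply: ideal0; apply: add_ideal.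
have bD n : {morph b n : x y / x + y}.
  by move=> x y; rewrite -[x]scale1r b_linr !scale1r.
have bZ n a x : b n (a *: x) = a *: b n x.
  by rewrite -[a *: x]addr0 b_linr b0 addr0.
have bl0 m : b 0 m = 0.
  by have := b_linl m 1 0 0; rewrite !scale1r addr0 => /eqP;
     rewrite -subr_eq0 opprD addNKr oppr_eq0 => /eqP.
have blD m : {morph b^~ m : x y / x + y}.
  by move=> x y /=; rewrite -[x]scale1r b_linl !scale1r.
have blZ m a x : b (a *: x) m = a *: b x m.
  by rewrite -[a *: x]addr0 b_linl bl0 addr0.
have bsum n r (F : nat -> S) : b n (\sum_(j < r) F j) = \sum_(j < r) b n (F j).
  elim: r => [|r IHr]; first by rewrite !big_ord0.
  by rewrite !big_ord_recr /= bD IHr.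
(* Modulo the chart ideal, m equals its homogenization, hence the combination of the degree d
   generators with coefficients [c d j m]. So b only sees these coordinates. *)
have bE n m : (msize m <= d.+1)%N ->
    b n m = \sum_(j < (D d).1.1) b (c d j m *: n) ((D d).1.2 j).
  move=> md; have [_ _ h] := DP d.
  have := h _ (homogenizeP i d m); set w := \sum_(j < _) _ => Iw.
  have {1}-> : m = (m - homogenize i d m + (homogenize i d m - w)) + w by ring.
  rewrite bD bJ ?add0r.
    rewrite /w (bsum _ _ (fun j => (D d).2 j (homogenize i d m) *: (D d).1.2 j)).
    by apply: eq_bigr => j _; rewrite bZ blZ.
  by apply: idealD; [exact: add_ideal | apply: add_idr => //;
    exact: sub_homogenize | apply: add_idl].
rewrite big_seq (eq_bigr (fun u =>
  \sum_(j < (D d).1.1) b (c d j u.2 *: u.1) ((D d).1.2 j))); last first.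
  by move=> u us; rewrite bE ?sd.
rewrite -big_seq exchange_big big1 // => j _.
rewrite -[RHS](bl0 ((D d).1.2 j)) -(c0 j).
elim: (s) => [|u s' IHs]; rewrite ?big_nil ?bl0 // !big_cons blD IHs //.
Qed.

End ChartFlatness.

(** * The affine line as base curve *)

Section PolynomialLine.
Variable k : fieldType.
Local Notation A := {poly k}.

Lemma poly_ideal_principal (J : A -> Prop) : is_ideal J ->
  exists2 g, J g & forall f, J f -> exists c, f = c * g.
Proof.
move=> idJ; pose P n := `[< exists f, [/\ J f, f != 0 & size f = n] >].
have [/asboolP exP|noP] := boolP `[< exists n, P n >]; last first.
  exists 0 => [|f Jf]; first exact: ideal0.
  exists 0; rewrite mulr0; apply/eqP/negPn/negP => f0.
  by move/asboolP: noP; apply; exists (size f); apply/asboolP; exists f.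
case: (ex_minnP exP) => n /asboolP[g [Jg g0 sg]] nmin.
exists g => // f Jf; exists (f %/ g); apply/eqP.
rewrite -subr_eq0; apply/negPn/negP => r0.
have Er : f - f %/ g * g = f %% g by rewrite {1}(divp_eq f g) addrAC subrr add0r.
have : P (size (f %% g)).
  apply/asboolP; exists (f %% g); rewrite -Er; split=> //.
  by apply: idealB => //; apply: idealM.
by move/nmin; rewrite leqNgt -sg ltn_modp g0.
Qed.

(** The quotient of M by the common kernel of T_0, ..., T_(n-1) is a submodule of A^n, hence free
    because A = k[t] is a principal ideal domain. The induction on n adds at most one generator per
    functional. *)
Lemma dual_basis_functionals (M : lmodType A) (T : nat -> M -> A) n :
    (forall j a x y, T j (a *: x + y) = a * T j x + T j y) ->
  exists (e : nat -> M) (la : nat -> M -> A),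
  [/\ forall i a x y, la i (a *: x + y) = a * la i x + la i y,
      forall i x, (forall j, (j < n)%N -> T j x = 0) -> la i x = 0 &
      forall j x, (j < n)%N -> T j (x - \sum_(i < n) la i x *: e i) = 0].
Proof.
move=> Tlin; have TB j x y : T j (x - y) = T j x - T j y.
  by rewrite addrC -scaleN1r Tlin mulN1r addrC.
elim: n => [|n [e [la [la_lin la0 laT]]]].
  by exists (fun=> 0), (fun=> fun=> 0); split=> // i a x y; rewrite mulr0 addr0.
pose pr x := x - \sum_(i < n) la i x *: e i.
have prlin a x y : pr (a *: x + y) = a *: pr x + pr y.
  rewrite /pr scalerBr scaler_sumr.
  under eq_bigr do rewrite la_lin scalerDl.
  rewrite big_split /= opprD addrACA; congr (_ - _ + _).
  by apply: eq_bigr => i _; rewrite scalerA.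
(* [pr] maps M into the common kernel of the first n functionals and fixes that kernel, so the
   values of F are those of T_n there; they form an ideal, generated by some g. *)
pose F x := T n (pr x).
have Flin a x y : F (a *: x + y) = a * F x + F y by rewrite /F prlin Tlin.
have F0 : F 0 = 0.
  by have := Flin (-1) 0 0; rewrite scaler0 addr0 mulN1r addNr.
have idF : is_ideal (fun f => exists x, F x = f).
  split=> [|a b [x <-] [y <-]|a b [x <-]]; first by exists 0.
    by exists (1 *: x + y); rewrite Flin mul1r.
  by exists (a *: x + 0); rewrite Flin F0 addr0.
have [g [z Fz] gP] := poly_ideal_principal idF.
have TF x : (forall j, (j < n.+1)%N -> T j x = 0) -> F x = 0.
  move=> Tx; rewrite /F /pr big1 ?subr0 ?Tx // => i _.
  by rewrite la0 ?scale0r // => j jn; rewrite Tx // ltnW.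
have /choice[c cP] : forall x, exists c, F x = c * g.
  by move=> x; apply: gP; exists x.
(* If g = 0, then T_n brings nothing new: the extra generator is 0 and its functional is irrelevant.
   Otherwise the new generator is [pr z] with T_n-value g, and its functional is F divided by g. *)
have [g0|g0] := eqVneq g 0.
  exists (fun i => if (i < n)%N then e i else 0), la; split=> // [i x Tx|j x].
    by apply: la0 => j jn; apply: Tx; rewrite ltnW.
  rewrite big_ord_recr /= ltnn scaler0 addr0.
  rewrite (eq_bigr (fun i : 'I_n => la i x *: e i)) => [|i _]; last first.
    by rewrite ltn_ord.
  rewrite ltnS leq_eqVlt => /orP[/eqP->|]; last exact: laT.
  by rewrite -/(pr x) -/(F x) cP g0 mulr0.
exists (fun i => if (i < n)%N then e i else pr z).
exists (fun i => if (i < n)%N then la i else c); split=> [i a x y|i x Tx|j x].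
- case: ifP => // _; apply: (mulIf g0).
  by rewrite -cP Flin mulrDl -mulrA -!cP.
- case: ifP => _; first by apply: la0 => j jn; apply: Tx; rewrite ltnW.
  by apply: (mulIf g0); rewrite -cP mul0r; apply: TF.
rewrite big_ord_recr /= ltnn.
rewrite (eq_bigr (fun i : 'I_n => la i x *: e i)) => [|i _]; last first.
  by rewrite ltn_ord.
rewrite opprD addrA -/(pr x).
have -> : pr x - c x *: pr z = - c x *: pr z + pr x by rewrite scaleNr addrC.
rewrite ltnS Tlin leq_eqVlt => /orP[/eqP->|jn]; last first.
  by rewrite /pr !laT // mulr0 addr0.
by rewrite -/(F z) -/(F x) Fz cP mulNr addNr.
Qed.

(** If P = (g) lies in J = (h), then g = c h, and primality puts c or h in P. The first makes h a
    unit, the second gives J = P. *)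
Lemma poly_prime_maximal (P : A -> Prop) :
  is_prime P -> (exists2 a, P a & a <> 0) -> is_maximal P.
Proof.
move=> [idP P1 prP] [a Pa a0]; split=> // J idJ PJ J1.
have [g Pg gP] := poly_ideal_principal idP.
have [h Jh hP] := poly_ideal_principal idJ.
have g0 : g != 0.
  by apply/eqP => g0; have [c] := gP a Pa; rewrite g0 mulr0.
have [c gE] := hP g (PJ g Pg).
have /prP[Pc|Ph] : P (c * h) by rewrite -gE.
- case: J1; have [d cE] := gP c Pc.
  have /(mulIf g0) <- : d * h * g = 1 * g by rewrite mulrAC -cE -gE mul1r.
  exact: idealM.
- by move=> x /hP[d ->]; apply: idealM.
Qed.

Lemma mul_principal_square (P : A -> Prop) (g f : A) :
  (forall f, P f -> exists c, f = c * g) -> mul_id P P f ->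
  exists c, f = c * g ^+ 2.
Proof.
move=> gP Pf; apply: (Pf (principal (g ^+ 2))); first exact: principal_ideal.
move=> x [a [b [/gP[c ->] /gP[d ->] ->]]].
by exists (c * d); rewrite expr2 mulrACA.
Qed.

Lemma affine_line_nonsingular :
  nonsingular_affine_curve (polyC : {rmorphism k -> A}).
Proof.
split.
- exists 1%N, (fun=> 'X) => x; elim/poly_ind: x => [|x c [P ->]].
    by exists 0; rewrite mmap0.
  exists (P * 'X_ord0 + c%:MP); rewrite mmapD rmorphM /= mmapC.
  by rewrite mmapX mmap1U.
- split; last exact: poly_prime_maximal.
  exists (fun f : A => f.[0] = 0); split; last first.
    by exists 'X; rewrite ?hornerX //; apply/eqP; rewrite polyX_eq0.
  split=> [||a b].
  - split=> [|a b a0 b0|a b b0]; first by rewrite horner0.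
      by rewrite hornerD a0 b0 addr0.
    by rewrite hornerM b0 mulr0.
  - by rewrite hornerE; apply/eqP; rewrite oner_eq0.
  rewrite hornerM => /eqP; rewrite mulf_eq0.
  by case/orP => /eqP; [left|right].
move=> P [idP P1 maxP]; have [g Pg gP] := poly_ideal_principal idP.
(* The zero ideal is not maximal, since it is contained in the proper ideal generated by X. *)
have g0 : g != 0.
  apply/eqP => g0.
  have X0 : P 'X.
    apply: (maxP (principal 'X)); first exact: principal_ideal.
    - by move=> f /gP[c ->]; exists 0; rewrite g0 mulr0 mul0r.
    - by move=> [c] /(congr1 (horner^~ 0)); rewrite !hornerE => /eqP;
        rewrite oner_eq0.
    by exists 1; rewrite mul1r.
  by have [c /eqP] := gP _ X0; rewrite g0 mulr0 polyX_eq0.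
(* The generator g spans P/P^2, and it is not in P^2 since g = c g^2 would put 1 in P. *)
exists g; split=> // [/(mul_principal_square gP)[c]|a /gP[c ->]].
  rewrite expr2 mulrA -{1}[g]mul1r => /(mulIf g0) E.
  by apply: P1; rewrite E; apply: idealM.
by exists c; rewrite subrr => J idJ _; apply: ideal0.
Qed.

End PolynomialLine.

(** * Coordinates on P^3 *)

Definition o0 : 'I_4 := Ordinal (isT : 0 < 4)%N.
Definition o1 : 'I_4 := Ordinal (isT : 1 < 4)%N.
Definition o2 : 'I_4 := Ordinal (isT : 2 < 4)%N.
Definition o3 : 'I_4 := Ordinal (isT : 3 < 4)%N.

Lemma ord4P (P : 'I_4 -> Prop) : P o0 -> P o1 -> P o2 -> P o3 -> forall i, P i.
Proof.
move=> P0 P1 P2 P3 [[|[|[|[|//]]]] hi];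
  [have -> : Ordinal hi = o0 by exact: val_inj
  |have -> : Ordinal hi = o1 by exact: val_inj
  |have -> : Ordinal hi = o2 by exact: val_inj
  |have -> : Ordinal hi = o3 by exact: val_inj] => //.
Qed.

Definition mon (a i j l : nat) : 'X_{1..4} := [multinom [tuple a; i; j; l]].

Lemma mon_eta (m : 'X_{1..4}) : m = mon (m o0) (m o1) (m o2) (m o3).
Proof. by apply/mnmP; apply: ord4P; rewrite multinomE. Qed.

Lemma mdeg_mon a i j l : mdeg (mon a i j l) = (a + i + j + l)%N.
Proof. by rewrite /mdeg /= !big_cons big_nil addn0 !addnA. Qed.

Lemma mon_inj a i j l a' i' j' l' :
  (mon a i j l == mon a' i' j' l') = [&& a == a', i == i', j == j' & l == l'].
Proof.
apply/eqP/and4P => [E|[/eqP-> /eqP-> /eqP-> /eqP->]] //.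
have := congr1 (fun m : 'X_{1..4} => m o0) E.
have := congr1 (fun m : 'X_{1..4} => m o1) E.
have := congr1 (fun m : 'X_{1..4} => m o2) E.
have := congr1 (fun m : 'X_{1..4} => m o3) E.
by rewrite !multinomE /= !(tnth_nth 0%N) /= => -> -> -> ->.
Qed.

Lemma mon0E a i j l : mon a i j l o0 = a. Proof. by []. Qed.
Lemma mon1E a i j l : mon a i j l o1 = i. Proof. by []. Qed.
Lemma mon2E a i j l : mon a i j l o2 = j. Proof. by []. Qed.
Lemma mon3E a i j l : mon a i j l o3 = l. Proof. by []. Qed.
Definition monE := (mon0E, mon1E, mon2E, mon3E).

Definition iterX (A : comNzRingType) (i : 'I_4) : {poly {poly {poly {poly A}}}} :=
  nth 0 [:: 'X; 'X%:P; 'X%:P%:P; 'X%:P%:P%:P] i.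

(* The variables h, x, v, w are nested in this order, h being the outermost.  *)
(* Locked, since unfolding it during unification is prohibitively slow.       *)
HB.lock Definition iter_poly (A : comNzRingType) :
    {mpoly A[4]} -> {poly {poly {poly {poly A}}}} :=
  mmap (polyC \o polyC \o polyC \o polyC :
    {rmorphism A -> {poly {poly {poly {poly A}}}}}) (@iterX A).

Lemma iter_polyE (A : comNzRingType) (F : {mpoly A[4]}) : iter_poly F =
  mmap (polyC \o polyC \o polyC \o polyC :
    {rmorphism A -> {poly {poly {poly {poly A}}}}}) (@iterX A) F.
Proof. by rewrite iter_poly.unlock. Qed.

Lemma iter_poly_is_additive (A : comNzRingType) : additive (@iter_poly A).
Proof. by rewrite iter_poly.unlock; exact: raddfB. Qed.

HB.instance Definition _ (A : comNzRingType) :=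
  GRing.isAdditive.Build {mpoly A[4]} {poly {poly {poly {poly A}}}}
    (@iter_poly A) (@iter_poly_is_additive A).

Lemma iter_poly_is_multiplicative (A : comNzRingType) :
  multiplicative (@iter_poly A).
Proof. by rewrite iter_poly.unlock; split; [exact: rmorphM | exact: rmorph1]. Qed.

HB.instance Definition _ (A : comNzRingType) :=
  GRing.isMultiplicative.Build {mpoly A[4]} {poly {poly {poly {poly A}}}}
    (@iter_poly A) (@iter_poly_is_multiplicative A).

Section IteratedCoefficients.
Variable A : comNzRingType.
Local Notation S := {mpoly A[4]}.

Lemma iter_polyX i : iter_poly ('X_i : S) = iterX A i.
Proof. by rewrite iter_polyE mmapX mmap1U. Qed.

Lemma iter_polyC (c : A) : iter_poly (c%:MP : S) = c%:P%:P%:P%:P.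
Proof. by rewrite iter_polyE mmapC. Qed.

Lemma iter_polyZ (c : A) (F : S) : iter_poly (c *: F) = c%:P%:P%:P%:P * iter_poly F.
Proof. by rewrite -mul_mpolyC rmorphM /= iter_polyC. Qed.

Lemma iter_poly_mon a i j l :
  iter_poly ('X_[mon a i j l] : S) =
  'X^a * ('X^i * ('X^j * ('X^l)%:P)%:P)%:P.
Proof.
rewrite iter_polyE mmapX /mmap1 !big_ord_recl big_ord0 mulr1.
rewrite !multinomE !(tnth_nth 0%N) /= /iterX /= !rmorphM /= !rmorphXn /=.
by [].
Qed.

Lemma coef_iter_poly (F : S) a i j l :
  (iter_poly F)`_a`_i`_j`_l = F@_(mon a i j l).
Proof.
elim/mpolyind: F => [|c m F _ _ IH]; first by rewrite raddf0 !coef0 mcoeff0.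
rewrite [iter_poly _]raddfD 4!coefD IH mcoeffD mcoeffZ mcoeffX; congr (_ + _).
rewrite /= (mon_eta m) mon_inj iter_polyZ iter_poly_mon.
set a' := m o0; set i' := m o1; set j' := m o2; set l' := m o3.
rewrite coefCM coefXnM coefC.
have [aa|aa|->] := ltngtP a a'; first by rewrite mulr0 !coef0 mulr0.
  by rewrite subn_eq0 leqNgt aa mulr0 !coef0 mulr0.
rewrite subnn eqxx coefCM coefXnM coefC.
have [aa|aa|->] := ltngtP i i'; first by rewrite mulr0 !coef0 mulr0.
  by rewrite subn_eq0 leqNgt aa mulr0 !coef0 mulr0.
rewrite subnn eqxx coefCM coefXnM coefC.
have [aa|aa|->] := ltngtP j j'; first by rewrite mulr0 !coef0 mulr0.
  by rewrite subn_eq0 leqNgt aa mulr0 !coef0 mulr0.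
by rewrite subnn eqxx coefCM coefXn /= eq_sym.
Qed.

End IteratedCoefficients.

Lemma coef_iter_map (A B : comNzRingType) (t : {rmorphism A -> B}) F a i j l :
  (iter_poly (map_mpoly t F))`_a`_i`_j`_l = t (iter_poly F)`_a`_i`_j`_l.
Proof. by rewrite !coef_iter_poly mcoeff_map_mpoly. Qed.

Lemma coef_iter_pihomog (A : comNzRingType) d (F : {mpoly A[4]}) a i j l :
  (iter_poly (pihomog mdeg d F))`_a`_i`_j`_l =
  if (a + i + j + l == d)%N then (iter_poly F)`_a`_i`_j`_l else 0.
Proof. by rewrite !coef_iter_poly mcoeff_pihomog mdeg_mon. Qed.

Lemma poly_image_surj (S R : comNzRingType) (f : {rmorphism S -> {poly R}}) :
  (forall c, exists x, f x = c%:P) -> (exists x, f x = 'X) ->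
  forall p, exists x, f x = p.
Proof.
move=> fC [X fX]; elim/poly_ind => [|p c [x <-]]; first by exists 0; rewrite rmorph0.
by have [z <-] := fC c; exists (x * X + z); rewrite rmorphD rmorphM fX.
Qed.

Section Surjectivity.
Variable A : comNzRingType.
Local Notation S := {mpoly A[4]}.

(** This allows a polynomial to be prescribed by its coefficients in h and x, as is done for the
    corrections in [fam_lift_w], [fam_lift_v] and [plane_lift]. *)
Lemma iter_poly_surj p : exists F : S, iter_poly F = p.
Proof.
have X3 : exists F : S, iter_poly F = 'X%:P%:P%:P.
  by exists 'X_o3; rewrite iter_polyX.
have X2 : exists F : S, iter_poly F = 'X%:P%:P by exists 'X_o2; rewrite iter_polyX.
have X1 : exists F : S, iter_poly F = 'X%:P by exists 'X_o1; rewrite iter_polyX.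
have X0 : exists F : S, iter_poly F = 'X by exists 'X_o0; rewrite iter_polyX.
have C3 (c : {poly A}) : exists F : S, iter_poly F = c%:P%:P%:P.
  elim/poly_ind: c => [|c a [F E]]; first by exists 0; rewrite rmorph0 !polyC0.
  have [G GE] := X3; exists (F * G + a%:MP).
  by rewrite rmorphD rmorphM /= E GE iter_polyC !polyCD !polyCM.
have C2 (c : {poly {poly A}}) : exists F : S, iter_poly F = c%:P%:P.
  elim/poly_ind: c => [|c a [F E]]; first by exists 0; rewrite rmorph0 !polyC0.
  have [G GE] := X2; have [H HE] := C3 a; exists (F * G + H).
  by rewrite rmorphD rmorphM /= E GE HE !polyCD !polyCM.
have C1 (c : {poly {poly {poly A}}}) : exists F : S, iter_poly F = c%:P.
  elim/poly_ind: c => [|c a [F E]]; first by exists 0; rewrite rmorph0 !polyC0.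
  have [G GE] := X1; have [H HE] := C2 a; exists (F * G + H).
  by rewrite rmorphD rmorphM /= E GE HE !polyCD !polyCM.
exact: (poly_image_surj C1 X0).
Qed.

End Surjectivity.

(** * Monomial ideals *)

Section MonomialIdeals.
Variable A : comNzRingType.
Local Notation S := {mpoly A[4]}.
Implicit Types (F G : S) (D : pred 'X_{1..4}).

Lemma mpolyX_X_ideal (J : S -> Prop) m m' :
  is_ideal J -> J 'X_[m] -> (m <= m')%MM -> J 'X_[m'].
Proof.
by move=> idJ Jm mm'; rewrite -(submK mm') mpolyXD; apply: idealM.
Qed.

(** A monomial ideal encoded by its set D of standard monomials, those lying under the staircase; it
    is an ideal when D is closed under divisors. *)
Definition stair D F := forall m, D m -> F@_m = 0.

Definition down_closed D := forall m m', D (m + m')%MM -> D m.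

Lemma stair_ideal D : down_closed D -> is_ideal (stair D).
Proof.
move=> Ddown; split=> [m _|F G DF DG m Dm|F G DG m Dm].
- by rewrite mcoeff0.
- by rewrite mcoeffD DF // DG // addr0.
rewrite mcoeffM big1 // => -[m1 m2] /= /eqP E.
by rewrite [G@_m2]DG ?mulr0 // (Ddown m2 m1) // addmC -E.
Qed.

(** When D is stable under multiplication by X_i, this variable is a nonzerodivisor modulo the
    ideal, which is therefore saturated. *)
Lemma stair_closed_subscheme D i :
  down_closed D -> (forall m, D m -> D (m + U_(i))%MM) ->
  closed_subscheme (stair D).
Proof.
move=> Ddown Di; split; first split; first exact: stair_ideal.
  move=> d F DF m Dm; rewrite mcoeff_pihomog; case: ifP => // _; exact: DF.
move=> F [n /(_ (U_(i) *+ n)%MM)]; rewrite mdegMn mdeg1 mul1n => /(_ erefl) DF.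
move=> m Dm; rewrite -(mcoeffMX F (U_(i) *+ n)%MM m) mulrC addmC; apply: DF.
elim: n => [|n IHn]; first by rewrite mulm0n addm0.
by rewrite mulmSr addmA; apply: Di.
Qed.

Lemma sub_stair D J F : is_ideal J ->
  (forall m, ~~ D m -> J 'X_[m]) -> stair D F -> J F.
Proof.
move=> idJ hJ DF; rewrite (mpolyE F); apply: ideal_sum => // m _.
rewrite -mul_mpolyC; have [Dm|/hJ] := boolP (D m); last exact: idealM.
by rewrite DF // mpolyC0 mul0r; apply: ideal0.
Qed.

Lemma stairX D m : ~~ D m -> stair D 'X_[m].
Proof.
by move=> Dm m' Dm'; rewrite mcoeffX; case: eqP => // E; rewrite E Dm' in Dm.
Qed.

End MonomialIdeals.

(** The standard monomials of degree n, enumerated by [s], form a basis of the quotient in that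
    degree. *)
Lemma hilbert_function_stair (k : fieldType) (D : pred 'X_{1..4}) n
    (s : seq 'X_{1..4}) :
  uniq s -> (forall m, (m \in s) = (mdeg m == n) && D m) ->
  hilbert_function (stair D : {mpoly k[4]} -> Prop) n (size s).
Proof.
move=> us sP; exists (fun i => 'X_[nth 0%MM s i]); split=> [i|F Fn].
  rewrite dhomogX /=.
  by have := mem_nth 0%MM (ltn_ord i); rewrite sP => /andP[].
have coefs (c : {ffun 'I_(size s) -> k}) (i : 'I_(size s)) :
    (\sum_j c j *: 'X_[nth 0%MM s j])@_(nth 0%MM s i) = c i.
  rewrite raddf_sum (bigD1 i) //= mcoeffZ mcoeffX eqxx mulr1 big1 ?addr0 //.
  move=> j ji; rewrite mcoeffZ mcoeffX nth_uniq //.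
  by rewrite (inj_eq val_inj) (negPf ji) mulr0.
exists [ffun i : 'I_(size s) => F@_(nth 0%MM s i)]; split=> [m Dm|c hc].
  rewrite mcoeffB; have [md|md] := eqVneq (mdeg m) n; last first.
    rewrite (dhomog_nemf_coeff Fn) // raddf_sum big1 ?subr0 // => j _.
    rewrite /= mcoeffZ mcoeffX; case: eqP => [E|]; rewrite ?mulr0 //.
    have := mem_nth 0%MM (ltn_ord j); rewrite sP E => /andP[/eqP E'].
    by rewrite E' eqxx in md.
  have ms : m \in s by rewrite sP md eqxx.
  have h : (index m s < size s)%N by rewrite index_mem.
  have := coefs [ffun i : 'I_(size s) => F@_(nth 0%MM s i)] (Ordinal h).
  by rewrite ffunE /= nth_index // => ->; rewrite subrr.
apply/ffunP => i; rewrite ffunE.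
have /hc : D (nth 0%MM s i).
  by have := mem_nth 0%MM (ltn_ord i); rewrite sP => /andP[].
by rewrite mcoeffB coefs => /eqP; rewrite subr_eq0 => /eqP.
Qed.

Lemma pihomog_combination (A : nzRingType) n d (F : {mpoly A[n]}) r
    (c : 'I_r -> A) (e : 'I_r -> {mpoly A[n]}) : F \is d.-homog ->
  F - \sum_(i < r) c i *: pihomog mdeg d (e i) =
  pihomog mdeg d (F - \sum_(i < r) c i *: e i).
Proof.
move=> Fd; rewrite [RHS]raddfB /= pihomog_dE // [pihomog _ _ (\sum_(_ < _) _)]raddf_sum.
by congr (_ - _); apply: eq_bigr => i _; rewrite /= linearZ.
Qed.

(** In degree d only the finitely many equations of that degree matter, so [dual_basis_functionals]
    applies to them. Taking the degree d parts of the generators it provides makes the remainder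
    homogeneous, so the equations of other degrees hold for it automatically. *)
Lemma equations_dual_basis (k : fieldType) (C : eqType) (dg : C -> nat)
    (T : C -> {mpoly {poly k}[4]} -> {poly k}) :
    (forall c a F G, T c (a *: F + G) = a * T c F + T c G) ->
    (forall c d F, T c (pihomog mdeg d F) = if dg c == d then T c F else 0) ->
    (forall d, exists s : seq C, forall c, dg c = d -> c \in s) ->
  forall d, graded_dual_basis (fun F => forall c, T c F = 0) d.
Proof.
move=> Tlin Tdg Cfin d; have [s sP] := Cfin d.
pose T' j F := if onth s j is Some c then T c F else 0.
have T'lin j a F G : T' j (a *: F + G) = a * T' j F + T' j G.
  by rewrite /T'; case: onth => [c|]; rewrite ?Tlin // mulr0 addr0.
have [e [la [la_lin la0 laT]]] := dual_basis_functionals (size s) T'lin.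
exists (size s), (fun i => pihomog mdeg d (e i)), la; split=> // [i F TF|F Fd c].
  by apply: la0 => j _; rewrite /T'; case: onth.
rewrite pihomog_combination //.
rewrite Tdg; case: eqP => // /sP cs.
have := laT (index c s) F; rewrite index_mem => /(_ cs).
by rewrite /T' onthE (nth_map c) ?index_mem // nth_index.
Qed.

(** * The family *)

Section LowOrderTerms.
Variable R : nzRingType.
Implicit Types P Q : {poly R}.

Lemma coef1M P Q : (P * Q)`_1 = P`_0 * Q`_1 + P`_1 * Q`_0.
Proof. by rewrite coefM !big_ord_recl big_ord0 addr0. Qed.

Lemma coefM_low P Q d : (forall i, (i < d)%N -> Q`_i = 0) ->
  [/\ forall i, (i < d)%N -> (P * Q)`_i = 0, (P * Q)`_d = P`_0 * Q`_d &
      (P * Q)`_d.+1 = P`_0 * Q`_d.+1 + P`_1 * Q`_d].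
Proof.
move=> Q0; split=> [i id||]; rewrite coefM.
- rewrite big1 // => j _; rewrite Q0 ?mulr0 //.
  exact: leq_ltn_trans (leq_subr _ _) id.
- rewrite big_ord_recl subn0 big1 ?addr0 // => j _.
  by rewrite Q0 ?mulr0 // lift0; have := ltn_ord j; lia.
rewrite 2!big_ord_recl subn0 lift0 subSS subn0 big1 ?addr0 // => j _.
by rewrite Q0 ?mulr0 // !lift0; have := ltn_ord j; lia.
Qed.

End LowOrderTerms.

Lemma coefM_low_cancel (R : idomainType) (P Q : {poly R}) d : P`_0 != 0 ->
  (forall i, (i < d)%N -> (P * Q)`_i = 0) -> forall i, (i < d)%N -> Q`_i = 0.
Proof.
move=> P0; elim: d => // d IHd PQ i; rewrite ltnS leq_eqVlt.
have Q0 : forall i, (i < d)%N -> Q`_i = 0.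
  by apply: IHd => j jd; apply: PQ; apply: ltnW.
case/orP => [/eqP->|]; last exact: Q0.
have [_ E _] := coefM_low P Q0.
have := PQ d (ltnSn d); rewrite E => /eqP; rewrite mulf_eq0 (negPf P0).
by move/eqP.
Qed.

(* These identities are stated over an abstract ring because [ring] is        *)
(* extremely slow on nested polynomial rings.                                 *)
Lemma eq1_ring (R : comNzRingType) (W T g a b : R) :
  W * (g * a) + T * (g * b) = g * (W * a + T * b).
Proof. ring. Qed.

Lemma eq2_ring (R : comNzRingType) (W U V T g g1 a a1 b b1 : R) :
  W * U * (g * a1 + g1 * a) + V * (g * b) + T * U * (g * b1 + g1 * b) =
  g * (W * U * a1 + V * b + T * U * b1) + g1 * U * (W * a + T * b).
Proof. ring. Qed.

Lemma eqD_ring (R : comNzRingType) (W T a a' b b' : R) :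
  W * (a + a') + T * (b + b') = W * a + T * b + (W * a' + T * b').
Proof. ring. Qed.

Section Family.
Variables (A : comNzRingType) (s m r : nat) (t : A).
Local Notation S := {mpoly A[4]}.
Local Notation B := {poly {poly A}}.
Local Notation P4 := {poly {poly B}}.
Implicit Types (E : P4) (F G : S) (b : B).

(* The parameters encode y = s + 2 and p = s + m + 2.                         *)
Definition eq1 E : B := ('X^(m + 1))%:P * E`_0`_(s + m + 2) + t%:P%:P * E`_1`_s.

Definition eq2 E : B := ('X^(2 * m + 2 + r))%:P * E`_0`_(s + m + 2).+1 +
  'X^(m + r) * E`_1`_s + t%:P%:P * ('X^(m + 1 + r))%:P * E`_1`_s.+1.

Definition fam F := let E := iter_poly F in
  [/\ forall i, (i < s)%N -> E`_1`_i = 0,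
      forall i, (i < s + m + 2)%N -> E`_0`_i = 0, eq1 E = 0 & eq2 E = 0].

(** Write E = a + h b and E' = g + h g' modulo h^2. In the coefficient g b + g' a of h, the term g'
    a starts in order s + m + 2 in x and does not reach the orders s and s + 1 used here. The
    exponent 2m + 2 + r = (m + 1) + (m + 1 + r) is what makes the terms in g_1 combine to a multiple
    of [eq1]. *)
Lemma mul_low E E' : let g := E'`_0 in
    (forall i, (i < s)%N -> E`_1`_i = 0) ->
    (forall i, (i < s + m + 2)%N -> E`_0`_i = 0) ->
  [/\ forall i, (i < s)%N -> (E' * E)`_1`_i = 0,
      forall i, (i < s + m + 2)%N -> (E' * E)`_0`_i = 0,
      eq1 (E' * E) = g`_0 * eq1 E &
      eq2 (E' * E) = g`_0 * eq2 E + g`_1 * ('X^(m + 1 + r))%:P * eq1 E].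
Proof.
rewrite /eq1 /eq2 => /=.
rewrite coef0M coef1M.
move: (E`_0) (E`_1) (E'`_0) (E'`_1) => a b g g' b0 a0.
have [ga0 gaE gaS] := coefM_low g a0.
have [gb0 gbE gbS] := coefM_low g b0.
have [g'0 _ _] := coefM_low g' a0.
have g's : (g' * a)`_s = 0 by apply: g'0; lia.
have g'S : (g' * a)`_s.+1 = 0 by apply: g'0; lia.
rewrite gaE gaS !coefD gbE gbS g's g'S.
split.
- by move=> i im; rewrite coefD gb0 // g'0 ?addr0 //; lia.
- exact: ga0.
- by rewrite addr0; apply: eq1_ring.
have -> : (2 * m + 2 + r = (m + 1) + (m + 1 + r))%N by lia.
by rewrite !addr0 exprD polyCM; apply: eq2_ring.
Qed.

Lemma fam_ideal : is_ideal fam.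
Proof.
split=> [|F G [a1 a2 a3 a4] [b1 b2 b3 b4]|G F [E1 E0 e1 e2]].
- by rewrite /fam /eq1 /eq2 rmorph0 !coef0; split=> [i _|i _||];
    rewrite ?coef0 ?mulr0 ?addr0.
- rewrite /fam rmorphD /=; split=> [i im|i im||].
  + by rewrite !coefD a1 // b1 // addr0.
  + by rewrite !coefD a2 // b2 // addr0.
  + by rewrite -[RHS](addr0 0) -{1}a3 -b3 /eq1 !coefD eqD_ring.
  + rewrite -[RHS](addr0 0) -{1}a4 -b4 /eq2 !coefD eqD_ring mulrDr.
    by rewrite [RHS]addrACA.
have [h1 h2 h3 h4] := mul_low (iter_poly G) E1 E0.
by rewrite /fam rmorphM; split=> //; rewrite ?h3 ?h4 e1 ?e2 !mulr0 ?addr0.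
Qed.

Definition fam_eqn (c : bool * nat * nat * nat) F : A :=
  let: (b, i, j, l) := c in let E := iter_poly F in
  if b then if (i < s)%N then E`_1`_i`_j`_l else 0
  else if (i < s + m + 2)%N then E`_0`_i`_j`_l
  else if i == (s + m + 2)%N then (eq1 E)`_j`_l
  else if i == (s + m + 2).+1 then (eq2 E)`_j`_l else 0.

(** The degree of the monomials whose coefficients enter the equation. The subtraction for [eq2]
    truncates only when 1 + s + j + l < m + r, and then every term of the equation is absent. *)
Definition fam_eqn_deg (c : bool * nat * nat * nat) : nat :=
  let: (b, i, j, l) := c in
  if b then (1 + i + j + l)%N
  else if i == (s + m + 2)%N then (1 + s + j + l)%N
  else if i == (s + m + 2).+1 then (1 + s + j + l - (m + r))%N
  else (i + j + l)%N.

Lemma famP F : fam F <-> forall c, fam_eqn c F = 0.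
Proof.
split=> [[h1 h2 h3 h4] [[[b i] j] l] /=|h].
  case: b; first by case: ifP => // im; rewrite h1 // !coef0.
  case: ifP => im; first by rewrite h2 // !coef0.
  by rewrite h3 h4 !coef0 !if_same.
split=> [i im|i im||]; apply/polyP => j; apply/polyP => l; rewrite !coef0.
- by have := h (true, i, j, l); rewrite /= im.
- by have := h (false, i, j, l); rewrite /= im.
- by have := h (false, s + m + 2, j, l)%N; rewrite /= ltnn eqxx.
have := h (false, (s + m + 2).+1, j, l)%N; rewrite /= ltnNge leqnSn /=.
by rewrite eqxx gtn_eqF.
Qed.

Lemma coef_eq1 E j l : (eq1 E)`_j`_l =
  (if (l < m + 1)%N then 0 else E`_0`_(s + m + 2)`_j`_(l - (m + 1))) +
  t * E`_1`_s`_j`_l.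
Proof. by rewrite /eq1 !coefD !coefCM coefXnM. Qed.

Lemma coef_eq2 E j l : (eq2 E)`_j`_l =
  (if (l < 2 * m + 2 + r)%N then 0
   else E`_0`_(s + m + 2).+1`_j`_(l - (2 * m + 2 + r))) +
  (if (j < m + r)%N then 0 else E`_1`_s`_(j - (m + r))`_l) +
  t * (if (l < m + 1 + r)%N then 0 else E`_1`_s.+1`_j`_(l - (m + 1 + r))).
Proof.
rewrite /eq2 !coefD -mulrA !coefCM !coefXnM; congr (_ + _ + _).
by case: ifP; rewrite ?coef0.
Qed.

Lemma fam_eqn_linear c a F G :
  fam_eqn c (a *: F + G) = a * fam_eqn c F + fam_eqn c G.
Proof.
have cE x i j l : (iter_poly (a *: F + G))`_x`_i`_j`_l =
    a * (iter_poly F)`_x`_i`_j`_l + (iter_poly G)`_x`_i`_j`_l.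
  by rewrite !coef_iter_poly mcoeffD mcoeffZ.
case: c => [[[b i] j] l] /=; rewrite !coef_eq1 !coef_eq2 !cE.
by case: b; repeat case: ifP => _; ring.
Qed.

Lemma fam_eqn_pihomog c d F :
  fam_eqn c (pihomog mdeg d F) = if fam_eqn_deg c == d then fam_eqn c F else 0.
Proof.
case: c => [[[b i] j] l] /=; rewrite !coef_eq1 !coef_eq2 !coef_iter_pihomog.
case: b; first by case: (ltnP i s); rewrite ?if_same.
have [h1|h1] := ltnP i (s + m + 2).
  have -> : (i == s + m + 2)%N = false by apply/eqP; lia.
  by have -> : (i == (s + m + 2).+1)%N = false by apply/eqP; lia.
have [_|h2] := eqVneq i (s + m + 2)%N.
  rewrite !add0n; case: (ltnP l (m + 1)) => hl /=.
    by rewrite !add0r; case: ifP => _; rewrite ?mulr0.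
  have -> : (s + m + 2 + j + (l - (m + 1)) = 1 + s + j + l)%N by lia.
  by case: ifP => _; rewrite ?mulr0 ?addr0.
have [_|h3] := eqVneq i (s + m + 2).+1; last by rewrite if_same.
have -> : (0 + (s + m + 2).+1 + j + (l - (2 * m + 2 + r)) == d)%N =
  if (l < 2 * m + 2 + r)%N then (s + m + 3 + j == d)%N
  else (1 + s + j + l - (m + r) == d)%N.
  by case: ltnP => hl; apply/eqP/eqP; lia.
have -> : (1 + s + (j - (m + r)) + l == d)%N =
  if (j < m + r)%N then (1 + s + l == d)%N
  else (1 + s + j + l - (m + r) == d)%N.
  by case: ltnP => hl; apply/eqP/eqP; lia.
have -> : (1 + s.+1 + j + (l - (m + 1 + r)) == d)%N =
  if (l < m + 1 + r)%N then (1 + s.+1 + j == d)%N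
  else (1 + s + j + l - (m + r) == d)%N.
  by case: ltnP => hl; apply/eqP/eqP; lia.
by case: (ltnP l (2 * m + 2 + r)) => _; case: (ltnP j (m + r)) => _;
  case: (ltnP l (m + 1 + r)) => _ /=; case: ifP => _; rewrite ?mulr0 ?addr0.
Qed.

Lemma fam_eqn_finite d :
  exists l : seq (bool * nat * nat * nat),
  forall c, fam_eqn_deg c = d -> c \in l.
Proof.
pose M := (d + s + m + m + r + 4)%N.
exists [seq (u, l) | u <- [seq (u, j) | u <- [seq (e, i) | e <- [:: true; false],
  i <- iota 0 M], j <- iota 0 M], l <- iota 0 M].
move=> [[[b i] j] l] h.
have hM : [&& i < M, j < M & l < M]%N.
  move: h; rewrite /M /=; case: b; first by lia.
  by case: eqP => [->|_]; [lia|case: eqP => [->|_]; lia].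
case/and3P: hM => hi hj hl.
apply: (allpairs_f (fun u l => (u, l))); last by rewrite mem_iota.
apply: (allpairs_f (fun u j => (u, j))); last by rewrite mem_iota.
apply: (allpairs_f (fun e i => (e, i))); last by rewrite mem_iota.
by case: b {h}.
Qed.

Lemma fam_homogeneous : homogeneous fam.
Proof.
split=> [|d F /famP h]; first exact: fam_ideal.
by apply/famP => c; rewrite fam_eqn_pihomog h if_same.
Qed.

End Family.

(** For G outside the ideal of the line h = x = 0, the lowest coefficient G_00 in A[v, w] is nonzero
    and can be cancelled from each equation in turn: first those on a, then on b, then [eq1], which
    removes the mixed term from [eq2]. *)
Lemma fam_primary (A : idomainType) s m r (t : A) F G :
  (iter_poly G)`_0`_0 != 0 -> fam s m r t (G * F) -> fam s m r t F.
Proof.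
move=> G0 [h1 h2 h3 h4].
have F0 : forall i, (i < s + m + 2)%N -> (iter_poly F)`_0`_i = 0.
  apply: (coefM_low_cancel G0) => i im; rewrite -[RHS](h2 i im).
  by rewrite rmorphM /= -coef0M.
have F1 : forall i, (i < s)%N -> (iter_poly F)`_1`_i = 0.
  apply: (coefM_low_cancel G0) => i im; rewrite -[RHS](h1 i im).
  rewrite rmorphM /= (coef1M (iter_poly G)) coefD.
  have [G1F0 _ _] := coefM_low (iter_poly G)`_1 F0.
  by rewrite G1F0 ?addr0 //; lia.
have [_ _ e1 e2] := mul_low r t (iter_poly G) F1 F0.
rewrite rmorphM /= in h3 h4.
have e0 : eq1 s m t (iter_poly F) = 0.
  by apply/eqP; move/eqP: h3; rewrite e1 mulf_eq0 (negPf G0).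
split=> //; apply/eqP; move/eqP: h4.
by rewrite e2 e0 mulr0 addr0 mulf_eq0 (negPf G0).
Qed.

(** Powers of w lie outside the ideal of the line, so [fam_primary] cancels them, which gives
    saturation. *)
Lemma fam_closed_subscheme (A : idomainType) s m r (t : A) :
  closed_subscheme (fam s m r t).
Proof.
split; first exact: fam_homogeneous.
move=> F [n /(_ (U_(o3) *+ n)%MM)]; rewrite mdegMn mdeg1 mul1n => /(_ erefl).
apply: fam_primary; rewrite -mpolyXn rmorphXn /= iter_polyX /iterX /=.
by rewrite -!rmorphXn !coefC /= polyC_eq0 monic_neq0 // monicXn.
Qed.

Lemma fam_dual_basis (k : fieldType) s m r (t : {poly k}) d :
  graded_dual_basis (fam s m r t) d.
Proof.
have -> : fam s m r t = fun F => forall c, fam_eqn s m r t c F = 0.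
  by apply: eq_idP => F; apply: famP.
apply: (equations_dual_basis (dg := fam_eqn_deg s m r)).
- exact: fam_eqn_linear.
- exact: fam_eqn_pihomog.
exact: fam_eqn_finite.
Qed.

(** * Fibres *)

Lemma fam_eqn_map (A A' : comNzRingType) (t : {rmorphism A -> A'}) s m r x c F :
  fam_eqn s m r (t x) c (map_mpoly t F) = t (fam_eqn s m r x c F).
Proof.
case: c => [[[b i] j] l]; rewrite /fam_eqn !coef_eq1 !coef_eq2 !coef_iter_map.
by case: b; repeat case: ifP => _; rewrite ?rmorphD ?rmorphM ?rmorph0.
Qed.

Lemma fam_map (A A' : comNzRingType) (t : {rmorphism A -> A'}) s m r x F :
  fam s m r x F -> fam s m r (t x) (map_mpoly t F).
Proof. by move=> /famP h; apply/famP => c; rewrite fam_eqn_map h rmorph0. Qed.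

Lemma lift_w_ring1 (R : comNzRingType) (W U X u a b : R) :
  W * (W * U * a - (X - u) * (U * b)) + X * (W * U * b) =
  W * U * (W * a + u * b).
Proof. ring. Qed.

Lemma lift_w_ring2 (R : comNzRingType) (N U V X u a b b0 : R) :
  N * (N * a - (X - u) * (U * b)) + V * (N * b0) + X * U * (N * b) =
  N * (N * a + V * b0 + u * U * b).
Proof. ring. Qed.

Lemma lift_v_ring1 (R : comNzRingType) (W Q V X u a a1 b0 b1 : R) :
  W * (V * a + (X - u) * (W * Q * a1 + (X + u) * Q * b1)) +
    X * (V * b0 - (X - u) * (W * Q * b1)) =
  V * (W * a + u * b0) + (X - u) * (W * (W * Q) * a1 + V * b0 + u * (W * Q) * b1).
Proof. ring. Qed.

Lemma lift_v_ring2 (R : comNzRingType) (N U V X u a1 b0 b1 : R) :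
  N * (V * a1) + V * (V * b0 - (X - u) * (U * b1)) + X * U * (V * b1) =
  V * (N * a1 + V * b0 + u * U * b1).
Proof. ring. Qed.

Section Fibre.
Variables (A : comNzRingType) (s m r : nat).
Local Notation S := {mpoly A[4]}.
Implicit Types (F G : S) (x u : A).

Lemma iter_polyM F G : iter_poly (F * G) = iter_poly F * iter_poly G.
Proof. exact: rmorphM. Qed.

Lemma iter_polyB F G : iter_poly (F - G) = iter_poly F - iter_poly G.
Proof. exact: raddfB. Qed.

Lemma iter_poly_x n : iter_poly ('X_o1 ^+ n : S) = ('X^n)%:P.
Proof. by rewrite rmorphXn /= iter_polyX /iterX /= -rmorphXn. Qed.

Lemma iter_poly_v n : iter_poly ('X_o2 ^+ n : S) = ('X^n)%:P%:P.
Proof. by rewrite rmorphXn /= iter_polyX /iterX /= -!rmorphXn. Qed.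

Lemma iter_poly_w n : iter_poly ('X_o3 ^+ n : S) = ('X^n)%:P%:P%:P.
Proof. by rewrite rmorphXn /= iter_polyX /iterX /= -!rmorphXn. Qed.

Lemma fam_sqr_h t : fam s m r t ('X_o0 ^+ 2 : S).
Proof.
have E : iter_poly ('X_o0 ^+ 2 : S) = 'X^2 by rewrite rmorphXn /= iter_polyX.
by rewrite /fam /eq1 /eq2 E !coefXn /= !coef0 !mulr0 !addr0; split=> // i _;
  rewrite coef0.
Qed.

Lemma fam_power_x t : fam s m r t ('X_o1 ^+ (s + m + 4) : S).
Proof.
rewrite /fam /eq1 /eq2 iter_poly_x !coefC !eqxx /= if_same !mulr0 !addr0 !coefXn.
have -> : (s + m + 2 == s + m + 4)%N = false by apply/eqP; lia.
have -> : ((s + m + 2).+1 == s + m + 4)%N = false by apply/eqP; lia.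
rewrite !mulr0; split=> // i im; rewrite ?coef0 // coefXn.
by have -> : (i == s + m + 4)%N = false by apply/eqP; lia.
Qed.

(* Corrections that move the fibre over u to the one over x, after            *)
(* multiplication by a power of w, respectively of v.                         *)
Lemma fam_lift_w u x F : fam s m r u F ->
  exists G, fam s m r x ('X_o3 ^+ (2 * m + 2 + r) * F - (x - u)%:MP * G).
Proof.
move=> [h1 h2 h3 h4]; move: h1 h2 h3 h4; set E := iter_poly F => h1 h2 h3 h4.
(* The correction changes only a_p and a_(p+1), where p = s + m + 2. Its two coefficients absorb the
   differences (x - u) b_s and (x - u) w^(m+1+r) b_(s+1) between the equations over x and over u, so
   both equations become w^(2m+2+r) times those over u. *)
pose c0 : {poly {poly A}} := ('X^(m + 1 + r))%:P * E`_1`_s.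
pose c1 : {poly {poly A}} := ('X^(m + 1 + r))%:P * E`_1`_s.+1.
pose D : {poly {poly {poly A}}} :=
  'X^(s + m + 2) * c0%:P + 'X^((s + m + 2).+1) * c1%:P.
have [G GE] := iter_poly_surj D%:P.
exists G; rewrite /fam; set E' := iter_poly _.
have EE : E' = ('X^(2 * m + 2 + r))%:P%:P%:P * E - (x - u)%:P%:P%:P%:P * iter_poly G.
  by rewrite /E' iter_polyB !iter_polyM iter_polyC iter_poly_w.
have E1 i : E'`_1`_i = ('X^(2 * m + 2 + r))%:P * E`_1`_i.
  by rewrite EE GE coefB !coefCM coefC /= mulr0 subr0 coefCM.
have E0 i : E'`_0`_i = ('X^(2 * m + 2 + r))%:P * E`_0`_i - (x - u)%:P%:P *
    ((if i == (s + m + 2)%N then c0 else 0) +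
     (if i == (s + m + 2).+1 then c1 else 0)).
  rewrite EE GE coefB !coefCM coefC /= coefB !coefCM coefD !coefMC !coefXn.
  by congr (_ - _ * (_ + _)); case: eqP => _; rewrite ?mul1r ?mul0r.
have xuE : (x - u)%:P%:P = x%:P%:P - u%:P%:P :> {poly {poly A}}.
  by rewrite !polyCB.
have e1 : eq1 s m x E' = ('X^(2 * m + 2 + r))%:P * eq1 s m u E.
  rewrite /eq1 E1 E0 eqxx ltn_eqF // addr0 xuE /c0.
  have -> : (2 * m + 2 + r = (m + 1) + (m + 1 + r))%N by lia.
  by rewrite (exprD _ (m + 1) (m + 1 + r)) polyCM; apply: lift_w_ring1.
have e2 : eq2 s m r x E' = ('X^(2 * m + 2 + r))%:P * eq2 s m r u E.
  rewrite /eq2 !E1 E0 eqxx gtn_eqF // add0r xuE /c1; exact: lift_w_ring2.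
split=> [i im|i im||]; rewrite -/E'.
- by rewrite E1 h1 // mulr0.
- rewrite E0 h2 //.
  have -> : (i == s + m + 2)%N = false by apply/eqP; lia.
  have -> : (i == (s + m + 2).+1)%N = false by apply/eqP; lia.
  by rewrite addr0 !mulr0 subr0.
- by rewrite e1 h3 mulr0.
by rewrite e2 h4 mulr0.
Qed.

Lemma fam_lift_v u x F : fam s m r u F ->
  exists G, fam s m r x ('X_o2 ^+ (m + r) * F - (x - u)%:MP * G).
Proof.
move=> [h1 h2 h3 h4]; move: h1 h2 h3 h4; set E := iter_poly F => h1 h2 h3 h4.
(* Subtracting (x - u) c1 from v^(m+r) b_s turns [eq2] over x into v^(m+r) times [eq2] over u. This
   disturbs [eq1], and c0 is chosen so that [eq1] becomes v^(m+r) [eq1] + (x - u) [eq2], both taken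
   over u. *)
pose c1 : {poly {poly A}} := ('X^(m + 1 + r))%:P * E`_1`_s.+1.
pose c0 : {poly {poly A}} := ('X^(m + 1 + r))%:P * E`_0`_(s + m + 2).+1 +
  (x%:P%:P + u%:P%:P) * ('X^r)%:P * E`_1`_s.+1.
pose D1 : {poly {poly {poly A}}} := 'X^s * c1%:P.
pose D0 : {poly {poly {poly A}}} := 'X^(s + m + 2) * c0%:P.
have [G GE] := iter_poly_surj ('X * D1%:P - D0%:P).
have G1 : (iter_poly G)`_1 = D1 by rewrite GE coefB coefXM !coefC subr0.
have G0 : (iter_poly G)`_0 = - D0 by rewrite GE coefB coefXM !coefC sub0r.
exists G; rewrite /fam; set E' := iter_poly _.
have EE : E' = ('X^(m + r))%:P%:P * E - (x - u)%:P%:P%:P%:P * iter_poly G.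
  by rewrite /E' iter_polyB !iter_polyM iter_polyC iter_poly_v.
have E1 i : E'`_1`_i = 'X^(m + r) * E`_1`_i -
    (x - u)%:P%:P * (if i == s then c1 else 0).
  rewrite EE coefB !coefCM G1 coefB !coefCM.
  by rewrite coefMC coefXn; case: eqP => _; rewrite ?mul1r ?mul0r.
have E0 i : E'`_0`_i = 'X^(m + r) * E`_0`_i +
    (x - u)%:P%:P * (if i == (s + m + 2)%N then c0 else 0).
  rewrite EE coefB !coefCM G0 coefB !coefCM.
  rewrite coefN coefMC coefXn mulrN opprK.
  by case: eqP => _; rewrite ?mul1r ?mul0r.
have xuE : (x - u)%:P%:P = x%:P%:P - u%:P%:P :> {poly {poly A}}.
  by rewrite !polyCB.
have e1 : eq1 s m x E' =
    'X^(m + r) * eq1 s m u E + (x - u)%:P%:P * eq2 s m r u E.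
  rewrite /eq1 /eq2 E1 E0 !eqxx xuE /c0 /c1.
  have -> : (2 * m + 2 + r = (m + 1) + (m + 1 + r))%N by lia.
  rewrite [in X in _ = _ + (_ - _) * X](exprD _ (m + 1) (m + 1 + r)).
  rewrite !(exprD _ (m + 1) r) !polyCM; exact: lift_v_ring1.
have e2 : eq2 s m r x E' = 'X^(m + r) * eq2 s m r u E.
  rewrite /eq2 !E1 E0 eqxx !gtn_eqF // !mulr0 addr0 subr0 xuE /c1.
  exact: lift_v_ring2.
split=> [i im|i im||]; rewrite -/E'.
- by rewrite E1 h1 // ltn_eqF // !mulr0 subr0.
- by rewrite E0 h2 // ltn_eqF // !mulr0 addr0.
- by rewrite e1 h3 h4 !mulr0 addr0.
by rewrite e2 h4 mulr0.
Qed.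

End Fibre.

Lemma map_mpoly_section (k : fieldType) (A : idomainType)
    (phi : {rmorphism k -> A}) (t : {rmorphism A -> k}) n (F : {mpoly k[n]}) :
  closed_point phi t -> map_mpoly t (map_mpoly phi F) = F.
Proof.
by move=> phiK; apply/mpolyP => m; rewrite !mcoeff_map_mpoly; apply: phiK.
Qed.

Lemma fibre_image_ideal (k : fieldType) (A : idomainType)
    (phi : {rmorphism k -> A}) (t : {rmorphism A -> k}) (I : {mpoly A[4]} -> Prop) :
  closed_point phi t -> is_ideal I ->
  is_ideal (fun f => exists2 g, I g & f = map_mpoly t g).
Proof.
move=> phiK idI; split=> [|f g [f' If ->] [g' Ig ->]|f g [g' Ig ->]].
- by exists 0; rewrite ?rmorph0 //; apply: ideal0.
- by exists (f' + g'); rewrite ?rmorphD //; apply: idealD.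
exists (map_mpoly phi f * g'); first exact: idealM.
rewrite rmorphM /=; congr (_ * _).
by rewrite map_mpoly_section.
Qed.

(** The equations specialize, and the specialized ideal is saturated, so it contains the fibre.
    Conversely, a constant lift of F satisfies the equations over t x instead of x; after
    multiplication by a power of any one variable it can be corrected by a multiple of x - phi (t
    x), which t kills. *)
Lemma fam_fibre (k : fieldType) (A : idomainType) (phi : {rmorphism k -> A})
    (t : {rmorphism A -> k}) s m r (x : A) :
  closed_point phi t -> fibre (fam s m r x) t = fam s m r (t x).
Proof.
move=> phiK; apply: eq_idP => F; split.
  have [_ sat] := fam_closed_subscheme s m r (t x).
  move=> [n h]; apply: sat; exists n => mm /h[g hg ->].
  exact: fam_map.
move=> hF; pose F' := map_mpoly phi F.
have tF' : map_mpoly t F' = F by exact: map_mpoly_section.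
have hF' : fam s m r (phi (t x)) F' by apply: fam_map.
have idA := fam_ideal s m r x.
have txu : t (x - phi (t x)) = 0.
  by rewrite rmorphB /=; apply/eqP; rewrite subr_eq0; apply/eqP/esym/phiK.
have lift (X : {mpoly A[4]}) (Y : {mpoly k[4]}) : map_mpoly t X = Y ->
    (exists G, fam s m r x (X * F' - (x - phi (t x))%:MP * G)) ->
    exists2 g, fam s m r x g & Y * F = map_mpoly t g.
  move=> XY [G hG]; exists (X * F' - (x - phi (t x))%:MP * G) => //.
  rewrite rmorphB !rmorphM /= map_mpolyC [X in X%:MP]txu mpolyC0 mul0r subr0.
  by rewrite XY tF'.
have lift0 (X : {mpoly A[4]}) Y : map_mpoly t X = Y -> fam s m r x X ->
    exists2 g, fam s m r x g & Y * F = map_mpoly t g.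
  move=> XY hX; apply: (lift _ _ XY); exists 0; rewrite mulr0 subr0.
  exact: idealMr.
have mapX (i : 'I_4) e : map_mpoly t ('X_i ^+ e) = 'X_i ^+ e.
  by rewrite rmorphXn /= map_mpolyX.
(* Exponents for h, x, v, w: the first two powers lie in the ideal itself, the last two are the
   multipliers of [fam_lift_v] and [fam_lift_w]. *)
pose e := [:: 2; s + m + 4; m + r; 2 * m + 2 + r]%N.
have hX i : exists2 g, fam s m r x g & 'X_i ^+ (nth 0%N e i) * F = map_mpoly t g.
  move: i; apply: ord4P => /=.
  - exact: (lift0 _ _ (mapX _ _) (fam_sqr_h _ _ _ _)).
  - exact: (lift0 _ _ (mapX _ _) (fam_power_x _ _ _ _)).
  - exact: (lift _ _ (mapX _ _) (fam_lift_v _ hF')).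
  - exact: (lift _ _ (mapX _ _) (fam_lift_w _ hF')).
(* A monomial of degree equal to the sum of these exponents is divisible by one of the four
   powers. *)
exists (2 + (s + m + 4) + (m + r) + (2 * m + 2 + r))%N => mm hmm.
have [i hi] : exists i : 'I_4, (nth 0%N e i <= mm i)%N.
  move: hmm; rewrite [in mdeg _](mon_eta mm) mdeg_mon => hmm.
  have [h0|h0] := leqP 2 (mm o0); first by exists o0.
  have [h1|h1] := leqP (s + m + 4) (mm o1); first by exists o1.
  have [h2|h2] := leqP (m + r) (mm o2); first by exists o2.
  by exists o3 => /=; lia.
have [g hg gE] := hX i.
have mE : (U_(i) *+ nth 0%N e i <= mm)%MM.
  apply/mnm_lepP => j; rewrite mulmnE mnm1E; case: eqP => [<-|_] //.
  by rewrite mul1n.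
rewrite -(submK mE) mpolyXD -mulrA -mpolyXn.
apply: (idealM _ (fibre_image_ideal phiK idA)); by exists g.
Qed.

(** * Points and the supporting line *)

Section Points.
Variable A : comNzRingType.
Local Notation S := {mpoly A[4]}.
Implicit Types (Q : S -> Prop) (F : S).

Lemma idealZ Q c F : is_ideal Q -> Q F -> Q (c *: F).
Proof. by move=> idQ QF; rewrite -mul_mpolyC; apply: idealM. Qed.

Lemma prime_exp Q F n : is_prime Q -> Q (F ^+ n) -> Q F.
Proof.
move=> [idQ Q1 prQ]; elim: n => [|n IHn]; first by rewrite expr0.
by rewrite exprS => /prQ[].
Qed.

Lemma monomial_congruence Q (c : 'I_4 -> A) z m : is_ideal Q ->
  (forall i, Q ('X_i - c i *: 'X_z)) ->
  Q ('X_[m] - (\prod_i c i ^+ m i) *: 'X_z ^+ mdeg m).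
Proof.
move=> idQ hc.
have mulQ a b a' b' : Q (a - b) -> Q (a' - b') -> Q (a * a' - b * b').
  move=> h h'; have -> : a * a' - b * b' = a * (a' - b') + b' * (a - b) by ring.
  by apply: idealD => //; apply: idealM.
have expQ a b n : Q (a - b) -> Q (a ^+ n - b ^+ n).
  move=> h; elim: n => [|n IHn]; first by rewrite !expr0 subrr; apply: ideal0.
  by rewrite !exprS; apply: mulQ.
rewrite mpolyXE_id mdegE.
elim: (index_enum _) => [|i e IHe].
  by rewrite !big_nil scale1r subrr; apply: ideal0.
rewrite !big_cons exprD -scalerA scalerAr scalerAl -exprZn.
exact: mulQ (expQ _ _ _ (hc i)) IHe.
Qed.

Lemma homog_congruence Q (c : 'I_4 -> A) z d F : is_ideal Q ->
  (forall i, Q ('X_i - c i *: 'X_z)) -> F \is d.-homog ->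
  Q (F - F.@[c] *: 'X_z ^+ d).
Proof.
move=> idQ hc /dhomogP Fd; rewrite {1}(mpolyE F) mevalE scaler_suml -sumrB.
rewrite big_seq; apply: (ideal_sum _ idQ) => m /Fd <-.
rewrite -scalerA -scalerBr; apply: (idealZ _ idQ).
exact: monomial_congruence.
Qed.

Lemma mem_homogeneous Q F : homogeneous Q -> is_ideal Q ->
  (forall d, Q (pihomog mdeg d F)) -> Q F.
Proof.
move=> hQ idQ h; rewrite (pihomog_sum_le (leqnSn (msize F))).
exact: ideal_sum.
Qed.

End Points.

(** Q is the closed point with coordinates c, and a form G of degree d is congruent to G(c) X_z^d
    modulo Q. If G lies in Q' but not in Q, then G(c) is nonzero, so Q' contains X_z and with it
    every variable, which is excluded for a point. *)
Lemma closed_point_max (k : fieldType) (Q Q' : {mpoly k[4]} -> Prop)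
    (c : 'I_4 -> k) z :
  is_point Q -> (forall i, Q ('X_i - c i *: 'X_z)) ->
  is_point Q' -> sub_id Q Q' -> sub_id Q' Q.
Proof.
move=> [hQ [idQ _ _] _] hc [[_ hQ'] prQ' [i Xi]] QQ' F Q'F.
have [idQ' Q'1 _] := prQ'.
apply: mem_homogeneous => // d.
have Q'd := hQ' d F Q'F; move: Q'd (pihomogP mdeg d F).
move: (pihomog _ _ _) => G Q'G Gd.
have QG := homog_congruence idQ hc Gd.
have [E|n0] := eqVneq (G.@[c]) 0; first by rewrite E scale0r subr0 in QG.
case: Xi; have Q'z : Q' 'X_z.
  apply: (@prime_exp _ _ _ d prQ').
  have -> : 'X_z ^+ d = (G.@[c])^-1%:MP * (G - (G - G.@[c] *: 'X_z ^+ d)) :> {mpoly k[4]}.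
    by rewrite opprB addrC subrK mul_mpolyC scalerA mulVf // scale1r.
  by apply: (idealM _ idQ'); apply: idealB => //; apply: QQ'.
rewrite -['X_i](subrK (c i *: 'X_z)); apply: (idealD idQ'); first exact: QQ'.
exact: idealZ.
Qed.

Section BinaryForms.
Variable k : closedFieldType.
Local Notation S := {mpoly k[4]}.
Implicit Types (p q : {poly k}).

(** The homogenization of p to a form of degree d in v and w. *)
Definition binary_form d p : S :=
  \sum_(j < d.+1) p`_j *: ('X_o2 ^+ j * 'X_o3 ^+ (d - j)).

Lemma binary_formD d p q : binary_form d (p + q) = binary_form d p + binary_form d q.
Proof. by rewrite -big_split; apply: eq_bigr => j _; rewrite coefD scalerDl. Qed.

Lemma binary_formZ d c p : binary_form d (c *: p) = c *: binary_form d p.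
Proof. by rewrite scaler_sumr; apply: eq_bigr => j _; rewrite coefZ scalerA. Qed.

Lemma binary_formS d p : (size p <= d.+1)%N ->
  binary_form d.+1 p = 'X_o3 * binary_form d p.
Proof.
move=> pd; rewrite /binary_form big_ord_recr /= (nth_default _ pd) scale0r addr0.
rewrite mulr_sumr; apply: eq_bigr => j _.
by rewrite -scalerAr mulrCA -exprS subSn // -ltnS.
Qed.

Lemma binary_formXM d p : binary_form d.+1 ('X * p) = 'X_o2 * binary_form d p.
Proof.
rewrite /binary_form big_ord_recl coefXM /= scale0r add0r mulr_sumr.
apply: eq_bigr => j _.
by rewrite /bump leq0n add1n coefXM /= -scalerAr mulrA -exprS subSS.
Qed.

(** Over an algebraically closed field a binary form splits into linear factors, and a prime
    containing it contains one of them. *)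
Lemma prime_binary_form (Q : S -> Prop) d p : is_prime Q -> p != 0 ->
  (size p <= d.+1)%N -> Q (binary_form d p) ->
  Q 'X_o3 \/ exists c, Q ('X_o2 - c *: 'X_o3).
Proof.
move=> [idQ Q1 prQ]; elim: d p => [|d IHd] p p0 pd.
  rewrite /binary_form big_ord1 !expr0 mulr1 => Qp; case: Q1.
  have pc : p`_0 != 0.
    by move: p0; rewrite (size1_polyC pd) polyC_eq0 coefC eqxx.
  have -> : 1 = (p`_0)^-1%:MP * (p`_0 *: 1) :> S.
    by rewrite mul_mpolyC scalerA mulVf // scale1r.
  exact: idealM.
(* If p has degree below d + 1, the form has a root at infinity and w factors out; otherwise a root
   of p gives a factor v - c w. *)
have [pd'|pd'] := leqP (size p) d.+1.
  rewrite binary_formS // => /prQ[|]; first by left.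
  exact: IHd.
have sp : size p = d.+2 by apply/eqP; rewrite eqn_leq pd pd'.
have /closed_rootP[c /factor_theorem[q pE]] : size p != 1%N by rewrite sp.
have q0 : q != 0 by apply: contraNneq p0 => q0; rewrite pE q0 mul0r.
have sq : (size q <= d.+1)%N.
  by move: sp; rewrite pE size_Mmonic ?monicXsubC // size_XsubC addn2 => -[->].
have -> : binary_form d.+1 p = ('X_o2 - c *: 'X_o3) * binary_form d q.
  have -> : p = 'X * q + (- c) *: q.
    by rewrite pE mulrBr mulrC scaleNr -mul_polyC [c%:P * q]mulrC.
  rewrite binary_formD binary_formZ binary_formXM binary_formS // mulrBl.
  by rewrite scaleNr scalerAl.
by case/prQ; [right; exists c | exact: IHd].
Qed.

End BinaryForms.

Section LineAndPoints.
Variable k : fieldType.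
Local Notation S := {mpoly k[4]}.
Implicit Types (F : S).

Definition line : S -> Prop := stair (fun m => (m o0 == 0) && (m o1 == 0))%N.

Lemma lineP F : line F <-> (iter_poly F)`_0`_0 = 0.
Proof.
split=> [LF|E m /andP[/eqP m0 /eqP m1]].
  apply/polyP => j; apply/polyP => l; rewrite !coef0 coef_iter_poly.
  exact: LF.
by rewrite (mon_eta m) m0 m1 -coef_iter_poly E !coef0.
Qed.

Lemma line_point : is_point line.
Proof.
have [h _] : closed_subscheme line.
  apply: (@stair_closed_subscheme _ _ o2) => [m m'|m] /=.
    by rewrite !mnmDE !addn_eq0 => /andP[/andP[-> _] /andP[-> _]].
  by rewrite !mnmDE !mnm1E !addn0.
split=> //; last first.
  exists o2 => /(_ U_(o2)%MM); rewrite mcoeffX eqxx !mnm1E => /(_ isT) /eqP.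
  by rewrite oner_eq0.
split; first by case: h.
  by move=> /(_ 0%MM); rewrite mcoeff1 eqxx !mnm0E => /(_ isT) /eqP; rewrite oner_eq0.
move=> F G /lineP; rewrite iter_polyM coef0M coef0M => /eqP.
by rewrite mulf_eq0 => /orP[] /eqP E; [left | right]; apply/lineP.
Qed.

Lemma sub_line (Q : S -> Prop) : is_ideal Q -> Q 'X_o0 -> Q 'X_o1 -> sub_id line Q.
Proof.
move=> idQ Q0 Q1 F; apply: sub_stair => // m.
rewrite negb_and -!lep1mP => /orP[h|h]; exact: mpolyX_X_ideal h.
Qed.

Definition line_origin : S -> Prop :=
  stair (fun m => [&& m o0 == 0, m o1 == 0 & m o2 == 0])%N.

Lemma line_originP F : line_origin F <-> (iter_poly F)`_0`_0`_0 = 0.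
Proof.
split=> [LF|E m /and3P[/eqP m0 /eqP m1 /eqP m2]].
  apply/polyP => l; rewrite !coef0 coef_iter_poly.
  exact: LF.
by rewrite (mon_eta m) m0 m1 m2 -coef_iter_poly E !coef0.
Qed.

Lemma line_origin_point : is_point line_origin.
Proof.
have [h _] : closed_subscheme line_origin.
  apply: (@stair_closed_subscheme _ _ o3) => [m m'|m] /=.
    rewrite !mnmDE !addn_eq0.
    by move=> /and3P[/andP[-> _] /andP[-> _] /andP[-> _]].
  by rewrite !mnmDE !mnm1E !addn0.
split=> //; last first.
  exists o3 => /(_ U_(o3)%MM); rewrite mcoeffX eqxx !mnm1E => /(_ isT) /eqP.
  by rewrite oner_eq0.
split; first by case: h.
  by move=> /(_ 0%MM); rewrite mcoeff1 eqxx !mnm0E => /(_ isT) /eqP; rewrite oner_eq0.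
move=> F G /line_originP; rewrite iter_polyM !coef0M => /eqP.
by rewrite mulf_eq0 => /orP[] /eqP E; [left | right]; apply/line_originP.
Qed.

(** The ideal contains h, x and X_a^n, so the only point that can contain it is the coordinate point
    where just X_z is nonzero; a and z stand for v and w in either order. *)
Lemma zero_dimensional_stair D i a z n :
    down_closed D -> (forall m, D m -> D (m + U_(i))%MM) ->
    (forall j : 'I_4, [\/ j = o0, j = o1, j = a | j = z]) ->
    (forall m, D m -> [&& m o0 == 0, m o1 == 0 & m a < n]%N) ->
  zero_dimensional (stair D : S -> Prop).
Proof.
move=> Ddown Di cover DP; split; first exact: stair_closed_subscheme Ddown Di.
move=> Q ptQ DQ; split=> // -[Q' [ptQ' QQ' nQ'Q _]]; apply: nQ'Q.
have [_ prQ _] := ptQ; have [idQ _ _] := prQ.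
have Q0 : Q 'X_o0.
  apply: DQ; apply: stairX; apply/negP => /DP/and3P[].
  by rewrite mnm1E.
have Q1 : Q 'X_o1.
  apply: DQ; apply: stairX; apply/negP => /DP/and3P[].
  by rewrite !mnm1E.
have Qa : Q 'X_a.
  apply: (@prime_exp _ _ _ n prQ); rewrite mpolyXn.
  apply: DQ; apply: stairX; apply/negP => /DP/and3P[_ _].
  by rewrite mulmnE mnm1E eqxx mul1n ltnn.
apply: (@closed_point_max _ _ _ (fun j => (j == z)%:R) z ptQ) => // j.
have [->|jz] := eqVneq j z; first by rewrite scale1r subrr; apply: ideal0.
by rewrite scale0r subr0; case: (cover j) jz => -> //; rewrite eqxx.
Qed.

End LineAndPoints.

Section LineDimension.
Variable k : closedFieldType.
Local Notation S := {mpoly k[4]}.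

(** The point h = x = v = 0 gives a chain of length one. Any point strictly above the line contains
    a nonzero binary form, hence a linear one in v and w, and so is closed. *)
Lemma line_dim : point_dim (@line k) 1.
Proof.
have ptL := line_point k.
split.
  exists (@line_origin k); split=> //; first exact: line_origin_point.
    by move=> F /lineP E; apply/line_originP; rewrite E coef0.
  move/(_ 'X_o2) => h; have : @line k 'X_o2.
    by apply: h; apply: stairX; rewrite !mnm1E.
  move=> /(_ U_(o2)%MM); rewrite mcoeffX eqxx !mnm1E => /(_ isT) /eqP.
  by rewrite oner_eq0.
move=> [Q1 [ptQ1 LQ1 nQ1L [Q2 [ptQ2 Q12 nQ21 _]]]]; apply: nQ21.
have [hQ1 prQ1 _] := ptQ1; have [idQ1 _ _] := prQ1.
have [F [d [Q1F Fd nLF]]] : exists F d, [/\ Q1 F, F \is d.-homog & ~ @line k F].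
  apply: contrapT => no; apply: nQ1L => F Q1F.
  have [hL [idL _ _] _] := ptL.
  apply: mem_homogeneous => // d; apply: contrapT => nL; apply: no.
  exists (pihomog mdeg d F), d; split=> //; first by case: hQ1 => _; apply.
  exact: pihomogP.
have L0 i : (i == o0) || (i == o1) -> @line k 'X_i.
  by move=> i01; apply: stairX; rewrite !mnm1E; case/orP: i01 => /eqP ->.
(* The restriction of F to the line, dehomogenized by w = 1; F agrees with its homogenization modulo
   h and x. *)
pose p := \poly_(j < d.+1) F@_(mon 0 0 j (d - j)).
have LFp : @line k (F - binary_form d p).
  move=> m /andP[/eqP m0 /eqP m1]; rewrite mcoeffB.
  have [md|md] := eqVneq (mdeg m) d; last first.
    rewrite (dhomog_nemf_coeff Fd) // raddf_sum big1 ?subr0 // => j _.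
    rewrite /= mcoeffZ !mpolyXn -mpolyXD mcoeffX.
    case: eqP => [E|_]; rewrite ?mulr0 //; move: md.
    rewrite -E mdegD !mdegMn !mdeg1 !mul1n subnKC ?eqxx //.
    by rewrite -ltnS.
  have mE : m = mon 0 0 (m o2) (m o3) by rewrite [LHS](mon_eta m) m0 m1.
  have dE : (m o2 + m o3)%N = d by rewrite -md {3}mE mdeg_mon.
  have hj : (m o2 < d.+1)%N by rewrite ltnS -dE leq_addr.
  have monE' (a b : nat) : 'X_o2 ^+ a * 'X_o3 ^+ b = 'X_[mon 0 0 a b] :> S.
    rewrite !mpolyXn -mpolyXD; congr 'X_[_]; apply/mnmP; apply: ord4P;
    by rewrite mnmDE !mulmnE !mnm1E ?monE ?mul1n ?addn0.
  rewrite /binary_form; under eq_bigr do rewrite monE'.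
  rewrite raddf_sum (bigD1 (Ordinal hj)) //= big1 => [|j jm].
    rewrite mcoeffZ mcoeffX coef_poly hj addr0 {3}mE -dE addKn.
    by rewrite -mE eqxx mulr1 subrr.
  rewrite /= mcoeffZ mcoeffX mE mon_inj /=; case: eqP => [E|_]; rewrite ?mulr0 //.
  by case/eqP: jm; apply: val_inj.
have Q1p : Q1 (binary_form d p).
  have -> : binary_form d p = F - (F - binary_form d p) by rewrite opprB addrC subrK.
  by apply: idealB => //; apply: LQ1.
have p0 : p != 0.
  apply/eqP => p0; apply: nLF; move: LFp; rewrite p0 /binary_form big1 ?subr0 //.
  by move=> j _; rewrite coef0 scale0r.
have Q10 := LQ1 _ (L0 o0 isT); have Q11 := LQ1 _ (L0 o1 isT).
have [Q13|[c Q12c]] := prime_binary_form prQ1 p0 (size_poly _ _) Q1p.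
  apply: (@closed_point_max _ _ _ (fun j => (j == o2)%:R) o2 ptQ1) => //.
  by apply: ord4P; rewrite /= ?scale0r ?subr0 // scale1r subrr; apply: ideal0.
apply: (@closed_point_max _ _ _
  (fun j => if j == o2 then c else (j == o3)%:R) o3 ptQ1) => //.
by apply: ord4P; rewrite /= ?scale0r ?subr0 // scale1r subrr; apply: ideal0.
Qed.

End LineDimension.

Section FamilyCurve.
Variables (k : closedFieldType) (s m r : nat) (t : k).
Local Notation S := {mpoly k[4]}.
Local Notation I := (fam s m r t : S -> Prop).

Lemma fam_sub_line : sub_id I (@line k).
Proof. by move=> F [_ h _ _]; apply/lineP; rewrite h ?coef0 //; lia. Qed.

Lemma line_sub_point (Q : S -> Prop) : is_point Q -> sub_id I Q -> sub_id (@line k) Q.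
Proof.
move=> [_ prQ _] IQ; have [idQ _ _] := prQ; apply: sub_line => //.
  by apply: (@prime_exp _ _ _ 2 prQ); apply: IQ; apply: fam_sqr_h.
by apply: (@prime_exp _ _ _ (s + m + 4) prQ); apply: IQ; apply: fam_power_x.
Qed.

(** The ideal contains powers of h and x, so the line is the only component. If Q = (I : f) is
    associated and contains some g outside the ideal of the line, then g f in I forces f in I by
    [fam_primary], and 1 would lie in Q; hence Q is the line. *)
Lemma fam_curve : is_curve I.
Proof.
have idI := fam_ideal s m r t; have ptL := line_point k.
have [_ [_ L1 _] _] := ptL.
have LI := fam_sub_line.
split=> [|/LI //|Q [ptQ IQ Qmin]|Q [ptQ [f fP]]].
- exact: fam_closed_subscheme.
- have -> : Q = @line k; last exact: line_dim.
  apply: eq_idP => F; split; last exact: line_sub_point.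
  by apply: Qmin => //; apply: line_sub_point.
have IQ : sub_id I Q.
  by move=> g Ig; apply/fP => a [b ->]; apply: idealM.
split=> // Q' ptQ' IQ' Q'Q g Qg; apply: (line_sub_point ptQ' IQ').
apply/lineP/eqP/negPn/negP => g0.
have If : I f.
  apply: (fam_primary g0); rewrite mulrC; move/fP: Qg; apply.
  by exists 1; rewrite mul1r.
have [_ [_ Q1 _] _] := ptQ; apply: Q1; apply/fP => a [b ->].
by rewrite mulr1; apply: idealM.
Qed.

End FamilyCurve.

(** * Triples of the fibres *)

Section HilbertPolynomials.
Variable k : fieldType.
Local Notation S := {mpoly k[4]}.

(** Standard monomials of (h, x^e), a multiple line in the plane. *)
Definition plane_multiple e (m : 'X_{1..4}) := ((m o0 == 0) && (m o1 < e))%N.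

(** Standard monomials of (h, x, X_a^n), a multiple point on the line. *)
Definition line_multiple a n (m : 'X_{1..4}) :=
  [&& m o0 == 0, m o1 == 0 & m a < n]%N.

Lemma mnm_eq_mon (m : 'X_{1..4}) a i j l :
  m o0 = a -> m o1 = i -> m o2 = j -> m o3 = l -> m = mon a i j l.
Proof. by move=> <- <- <- <-; apply: mon_eta. Qed.

Lemma mdegE4 (m : 'X_{1..4}) : mdeg m = (m o0 + m o1 + m o2 + m o3)%N.
Proof. by rewrite [in LHS](mon_eta m) mdeg_mon. Qed.

Lemma has_length_line_multiple a n : a \in [:: o2; o3] ->
  has_length (stair (line_multiple a n) : S -> Prop) n.
Proof.
move=> ha; exists n => d nd; exists n; last by rewrite hornerC.
pose g l := if a == o3 then mon 0 0 (d - l) l else mon 0 0 l (d - l).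
have gE l : (l < n)%N -> [/\ mdeg (g l) = d, line_multiple a n (g l) & g l a = l].
  rewrite /g /line_multiple => ln; move: ha; rewrite !inE => /orP[]/eqP-> /=;
  by rewrite mdeg_mon !monE; split=> //; lia.
have -> : n = size [seq g l | l <- iota 0 n] by rewrite size_map size_iota.
apply: hilbert_function_stair => [|m]; rewrite ?size_map ?size_iota.
  rewrite map_inj_in_uniq ?iota_uniq // => l l'; rewrite !mem_iota /= => ln ln' E.
  by have [_ _ <-] := gE l ln; have [_ _ <-] := gE l' ln'; rewrite E.
apply/mapP/andP => [[l]|[/eqP md /and3P[/eqP m0 /eqP m1 man]]].
  by rewrite mem_iota => /= ln ->; have [-> -> _] := gE l ln.
exists (m a); first by rewrite mem_iota.
move: md; rewrite mdegE4 m0 m1 /g => md; move: ha; rewrite !inE => /orP[]/eqP-> /=;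
by apply: mnm_eq_mon => //; lia.
Qed.

(** For each power x^i with i < e there are d - i + 1 monomials in v and w of complementary degree;
    summing these numbers gives a linear polynomial with leading coefficient e, valid for d >= e. *)
Lemma has_degree_plane_multiple e :
  has_degree (stair (plane_multiple e) : S -> Prop) e.
Proof.
exists (\sum_(i < e) (1 - i%:R)), e => d ed.
pose g i j := mon 0 i j (d - i - j).
pose l := [seq g i j | i <- iota 0 e, j <- iota 0 (d - i).+1].
have sl : size l = (\sum_(i < e) (d - i).+1)%N.
  rewrite size_allpairs_dep sumnE big_map -{1}[e]subn0 big_mkord.
  by apply: eq_bigr => i _; rewrite size_iota.
exists (size l); last first.
  rewrite sl natr_sum !hornerE -mulr_natl mulr1 -[X in X%:R * _]card_ord.
  rewrite -sum1_card natr_sum mulr_suml -big_split; apply: eq_bigr => i _ /=.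
  by rewrite mul1r -addn1 natrD natrB ?(ltnW (leq_trans (ltn_ord i) ed)) //; ring.
apply: hilbert_function_stair => [|m].
  apply: allpairs_uniq_dep => [|i _|]; try exact: iota_uniq.
  move=> [i j] [i' j'] _ _ /= /eqP; rewrite mon_inj /=.
  by case/and3P => /eqP -> /eqP ->.
apply/allpairsPdep/andP => [[i [j []]]|[/eqP md /andP[/eqP m0 m1]]].
  rewrite !mem_iota /= => ie ji ->; rewrite mdeg_mon /plane_multiple !monE ie.
  by split=> //; lia.
exists (m o1), (m o2); rewrite !mem_iota /=; move: md; rewrite mdegE4 m0 => md.
by split; [|lia|apply: mnm_eq_mon => //; lia].
Qed.

End HilbertPolynomials.

Section PlaneSections.
Variable k : fieldType.
Local Notation S := {mpoly k[4]}.
Implicit Types F : S.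

Lemma stair_plane_multipleP e F : stair (plane_multiple e) F <->
  forall i, (i < e)%N -> (iter_poly F)`_0`_i = 0.
Proof.
split=> [DF i ie|h m /andP[/eqP m0 m1]].
  apply/polyP => j; apply/polyP => l; rewrite !coef0 coef_iter_poly; apply: DF.
  by rewrite /plane_multiple !monE.
by rewrite (mon_eta m) m0 -coef_iter_poly h // !coef0.
Qed.

Lemma plane_multiple_down e : down_closed (plane_multiple e).
Proof. by move=> m m'; rewrite /plane_multiple !mnmDE; lia. Qed.

Lemma line_multiple_down a n : down_closed (line_multiple a n).
Proof. by move=> m m'; rewrite /line_multiple !mnmDE; lia. Qed.

Lemma power_x_plane e : eq_id
  (add_id (principal ('X_o1 ^+ e : S)) (principal 'X_o0)) (stair (plane_multiple e)).
Proof.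
have idD : is_ideal (stair (plane_multiple e) : S -> Prop).
  exact/stair_ideal/plane_multiple_down.
have idJ : is_ideal (add_id (principal ('X_o1 ^+ e : S)) (principal 'X_o0)).
  by apply: add_ideal; apply: principal_ideal.
move=> F; split=> [[a [b [[c ->] [d ->] ->]]]|].
  apply: (idealD idD); apply: (idealM _ idD); rewrite ?mpolyXn; apply: stairX.
    by rewrite /plane_multiple !mulmnE !mnm1E /= mul1n ltnn.
  by rewrite /plane_multiple !mnm1E.
apply: sub_stair => // m; rewrite negb_and -leqNgt => /orP[m0|m1].
  apply: (@mpolyX_X_ideal _ _ U_(o0)%MM) => //; last by rewrite lep1mP.
  by apply: add_idr; [exact: principal_ideal | exists 1; rewrite mul1r].
apply: (@mpolyX_X_ideal _ _ (U_(o1) *+ e)%MM) => //.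
  rewrite -mpolyXn; apply: add_idl; first exact: principal_ideal.
  by exists 1; rewrite mul1r.
apply/mnm_lepP => i; rewrite mulmnE mnm1E; case: eqP => [<-|_] //.
by rewrite mul1n.
Qed.

(** Standard monomials of (h, x^(p+1), x^p X_a^n), which is x^p (x, X_a^n) modulo h. *)
Definition plane_section p a n (m : 'X_{1..4}) :=
  ((m o0 == 0) && ((m o1 < p) || (m o1 == p) && (m a < n)))%N.

Lemma plane_section_down p a n : down_closed (plane_section p a n).
Proof. by move=> m m'; rewrite /plane_section !mnmDE; lia. Qed.

Lemma sub_plane_section (J : S -> Prop) p a n : a \in [:: o2; o3] -> is_ideal J ->
  J 'X_o0 -> J ('X_o1 ^+ p.+1) -> J ('X_o1 ^+ p * 'X_a ^+ n) ->
  sub_id (stair (plane_section p a n)) J.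
Proof.
move=> ha idJ J0 J1 Ja F; apply: sub_stair => // m.
have a1 : (o1 == a) = false by move: ha; rewrite !inE => /orP[]/eqP->.
rewrite negb_and negb_or negb_and -!leqNgt => /orP[m0|/andP[m1 m2]].
  by apply: (mpolyX_X_ideal idJ J0); rewrite lep1mP.
have [m1'|m1'] := ltnP p (m o1).
  rewrite mpolyXn in J1; apply: (mpolyX_X_ideal idJ J1).
  apply/mnm_lepP => i; rewrite mulmnE mnm1E; case: eqP => [<-|_] //.
  by rewrite mul1n.
rewrite !mpolyXn -mpolyXD in Ja; apply: (mpolyX_X_ideal idJ Ja).
apply/mnm_lepP => i; rewrite mnmDE !mulmnE !mnm1E.
have [<-|i1] := eqVneq o1 i; first by rewrite eq_sym a1 mul1n addn0.
rewrite mul0n add0n; have [<-|//] := eqVneq a i.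
by rewrite mul1n; case/orP: m2 => // /eqP; lia.
Qed.

Lemma plane_section_mul p a n : a \in [:: o2; o3] -> eq_id
  (add_id (mul_id (principal ('X_o1 ^+ p : S)) (stair (line_multiple a n)))
     (principal 'X_o0)) (stair (plane_section p a n)).
Proof.
move=> ha; have idD : is_ideal (stair (plane_section p a n) : S -> Prop).
  exact/stair_ideal/plane_section_down.
have a1 : (o1 == a) = false by move: ha; rewrite !inE => /orP[]/eqP->.
have a0 : (o0 == a) = false by move: ha; rewrite !inE => /orP[]/eqP->.
have idG (G : S -> Prop) : is_ideal (gen_id G).
  split=> [J idJ _|x y Gx Gy J idJ GJ|x y Gy J idJ GJ]; first exact: ideal0.
    by apply: idealD => //; [apply: Gx | apply: Gy].
  by apply: idealM => //; apply: Gy.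
set J := add_id _ _; have idJ : is_ideal J.
  by apply: add_ideal; [exact: idG | exact: principal_ideal].
have genM (x y : S) : principal ('X_o1 ^+ p) x -> stair (line_multiple a n) y ->
    J (x * y).
  move=> hx hy; apply: add_idl; first exact: principal_ideal.
  by move=> K _; apply; exists x, y.
have pf : principal ('X_o1 ^+ p : S) ('X_o1 ^+ p) by exists 1; rewrite mul1r.
move=> F; split=> [[x [y [hx [d ->] ->]]]|].
  apply: (idealD idD); last first.
    by apply: (idealM _ idD); apply: stairX; rewrite /plane_section !mnm1E.
  apply: hx => // _ [_ [G [[c ->] DG ->]]]; rewrite -mulrA; apply: (idealM _ idD).
  move=> m /andP[/eqP m0 m1].
  have [mp|mp] := leqP p (m o1); last first.
    rewrite mpolyXn; apply/memN_msupp_eq0/negP => /msuppM_le /allpairsP[[m' m''] /=].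
    rewrite msuppX inE => -[/eqP-> _ E]; move: mp.
    by rewrite E mnmDE mulmnE mnm1E eqxx mul1n ltnNge leq_addr.
  have mE : m = (U_(o1) *+ p + mon 0 (m o1 - p) (m o2) (m o3))%MM.
    by apply/mnmP; apply: ord4P; rewrite mnmDE mulmnE mnm1E ?monE ?mul1n ?subnKC.
  rewrite mE mpolyXn mulrC mcoeffMX; apply: DG; rewrite /line_multiple !monE /=.
  move: m1; rewrite ltnNge mp /= => /andP[/eqP-> man]; rewrite subnn eqxx /=.
  by move: ha man; rewrite !inE => /orP[]/eqP->.
apply: sub_plane_section => //.
- by apply: add_idr; [exact: idG | exists 1; rewrite mul1r].
- rewrite exprSr; apply: genM => //; apply: stairX.
  by rewrite /line_multiple !mnm1E.
apply: genM => //; rewrite mpolyXn; apply: stairX.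
by rewrite /line_multiple !mulmnE !mnm1E eqxx mul1n ltnn !andbF.
Qed.

Lemma line_multiple_zero_dim a n : a \in [:: o2; o3] ->
  zero_dimensional (stair (line_multiple a n) : S -> Prop).
Proof.
rewrite !inE => /orP[]/eqP->.
- apply: (@zero_dimensional_stair _ _ o3 o2 o3 n) => // [||].
  + exact: line_multiple_down.
  + by move=> m; rewrite /line_multiple !mnmDE !mnm1E !addn0.
  by apply: ord4P; [constructor 1|constructor 2|constructor 3|constructor 4].
apply: (@zero_dimensional_stair _ _ o2 o3 o2 n) => // [||].
+ exact: line_multiple_down.
+ by move=> m; rewrite /line_multiple !mnmDE !mnm1E !addn0.
by apply: ord4P; [constructor 1|constructor 2|constructor 4|constructor 3].
Qed.

End PlaneSections.

Lemma saturation_intro (A : comNzRingType) (J : {mpoly A[4]} -> Prop) F :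
  is_ideal J -> J F -> saturation J F.
Proof. by move=> idJ JF; exists 0%N => m _; apply: idealM. Qed.

Lemma cancel_ring1 (R : comNzRingType) (W U T : R) : W * U * T + T * U * - W = 0.
Proof. ring. Qed.

Lemma cancel_ring2 (R : comNzRingType) (W Q T : R) :
  W * (T * T * Q) + T * - (T * (W * Q)) = 0.
Proof. ring. Qed.

Lemma cancel_ring3 (R : comNzRingType) (V U T : R) : V * - (T * U) + T * U * V = 0.
Proof. ring. Qed.

Definition two_terms (R : nzRingType) a (c d : R) : {poly R} :=
  'X^a * c%:P + 'X^(a.+1) * d%:P.

Lemma nested_monomial0 (R : comNzRingType) (c d : R) a :
  c%:P%:P * (('X^a)%:P * d%:P%:P) = (two_terms a (c * d) 0)%:P.
Proof.
by rewrite /two_terms polyC0 mulr0 addr0 -!polyCM; congr _%:P; rewrite polyCM mulrCA.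
Qed.

Lemma nested_monomial1 (R : comNzRingType) (c : R) a :
  c%:P%:P * ('X^(a.+1))%:P = (two_terms a 0 c)%:P.
Proof. by rewrite /two_terms polyC0 mulr0 add0r -polyCM mulrC. Qed.

Lemma nested_monomial2 (R : comNzRingType) (d : R) a :
  ('X^(a.+1))%:P * d%:P%:P = (two_terms a 0 d)%:P.
Proof. by rewrite /two_terms polyC0 mulr0 add0r -polyCM. Qed.

Lemma coef_two_terms (R : nzRingType) a (c d : R) :
  [/\ forall i, (i < a)%N -> (two_terms a c d)`_i = 0,
      (two_terms a c d)`_a = c & (two_terms a c d)`_a.+1 = d].
Proof.
rewrite /two_terms; split=> [i ia||]; rewrite coefD !coefMC !coefXn.
- by rewrite !ltn_eqF ?mul0r ?addr0 // ltnW.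
- by rewrite eqxx ltn_eqF // mul1r mul0r addr0.
by rewrite eqxx gtn_eqF // mul1r mul0r add0r.
Qed.

Section FamilyTriples.
Variables (k : closedFieldType) (s m r : nat).
Local Notation S := {mpoly k[4]}.
Local Notation I := (fam s m r).
Implicit Types (t : k) (F : S).

(** To see that a form in the plane comes from the curve, it suffices to complete it by a multiple
    of h. Here b0 and b1 are the coefficients of x^s and x^(s+1) in that completion, and the
    hypotheses are [eq1] and [eq2]. *)
Lemma plane_lift t (M : S) (a0 a1 b0 b1 : {poly {poly k}}) :
    iter_poly M = (two_terms (s + m + 2) a0 a1)%:P ->
    ('X^(m + 1))%:P * a0 + t%:P%:P * b0 = 0 ->
    ('X^(2 * m + 2 + r))%:P * a1 + 'X^(m + r) * b0 +
      t%:P%:P * ('X^(m + 1 + r))%:P * b1 = 0 ->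
  add_id (I t) (principal ('X_o0 : S)) M.
Proof.
move=> ME e1 e2; have [G GE] := iter_poly_surj (two_terms s b0 b1)%:P.
exists (M + G * 'X_o0), (- G * 'X_o0); split; last by rewrite mulNr addrK.
  set E := iter_poly (M + G * 'X_o0).
  have EE : E = (two_terms (s + m + 2) a0 a1)%:P + (two_terms s b0 b1)%:P * 'X.
    by rewrite /E raddfD /= iter_polyM ME GE iter_polyX.
  have E0 : E`_0 = two_terms (s + m + 2) a0 a1.
    by rewrite EE coefD coefMX !coefC addr0.
  have E1 : E`_1 = two_terms s b0 b1 by rewrite EE coefD coefMX !coefC add0r.
  rewrite /fam -/E /eq1 /eq2 E0 E1; have [h ha ha'] := coef_two_terms (s + m + 2) a0 a1.
  have [h' hb hb'] := coef_two_terms s b0 b1.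
  by split=> //; rewrite ?ha ?ha' hb ?hb'.
by exists (- G).
Qed.

Lemma colon_plane t F : colon_id (I t) (principal ('X_o0 : S)) F <-> I t ('X_o0 * F).
Proof.
split=> [|h a [b ->]]; first by apply; exists 1; rewrite mul1r.
by rewrite -mulrA; apply: (idealM _ (fam_ideal s m r t)).
Qed.

Lemma fam_mulh t F : let E := (iter_poly F)`_0 in I t ('X_o0 * F) <->
  [/\ forall i, (i < s)%N -> E`_i = 0, t%:P%:P * E`_s = 0 &
      'X^(m + r) * E`_s + t%:P%:P * ('X^(m + 1 + r))%:P * E`_s.+1 = 0].
Proof.
move=> E; have E0 : (iter_poly ('X_o0 * F))`_0 = 0.
  by rewrite iter_polyM iter_polyX coefXM.
have E1 : (iter_poly ('X_o0 * F))`_1 = E.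
  by rewrite iter_polyM iter_polyX coefXM.
rewrite /fam /eq1 /eq2 E0 E1 !coef0 !mulr0 !add0r.
by split=> [[h1 _ h2 h3]|[h1 h2 h3]]; split=> // i _; rewrite coef0.
Qed.

(** For h F the a-terms vanish: [eq1] kills the coefficient of x^s in F modulo h, and then [eq2]
    kills that of x^(s+1). *)
Lemma colon_fam_neq0 t : t != 0 ->
  eq_id (stair (plane_multiple (s + 2))) (colon_id (I t) (principal ('X_o0 : S))).
Proof.
move=> t0 F; rewrite stair_plane_multipleP colon_plane fam_mulh.
have tn0 : t%:P%:P != 0 :> {poly {poly k}} by rewrite !polyC_eq0.
have wn0 : ('X^(m + 1 + r))%:P != 0 :> {poly {poly k}}.
  by rewrite polyC_eq0 monic_neq0 // monicXn.
split=> [h|[h1 /eqP h2 h3] i].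
  by split=> [i is_||]; rewrite ?h ?mulr0 ?addr0 //; lia.
move: h2 h3; rewrite mulf_eq0 (negPf tn0) /= => /eqP h2.
rewrite h2 mulr0 add0r => /eqP; rewrite !mulf_eq0 (negPf tn0) (negPf wn0) /=.
rewrite addn2 ltnS leq_eqVlt ltnS leq_eqVlt => /eqP h3.
by case/or3P => [/eqP->|/eqP->|/h1].
Qed.

(** At t = 0, [eq1] is empty for h F, and [eq2] only kills the coefficient of x^s. *)
Lemma colon_fam_eq0 :
  eq_id (stair (plane_multiple (s + 1))) (colon_id (I 0) (principal ('X_o0 : S))).
Proof.
move=> F; rewrite stair_plane_multipleP colon_plane fam_mulh.
rewrite !polyC0 !mul0r addr0 addn1.
split=> [h|[h1 _ h3] i].
  by split=> // [i is_|]; rewrite ?h ?mulr0 ?addr0 //; lia.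
rewrite ltnS leq_eqVlt => /orP[/eqP->|/h1 //].
by move/eqP: h3; rewrite mulf_eq0 (negPf (monic_neq0 (monicXn _ _))) => /eqP.
Qed.

(** The variable among v and w other than X_a is a nonzerodivisor modulo the monomial ideal, which
    is thus already saturated; it only remains to have its generators in I + (h). *)
Lemma saturation_plane_section t p a n :
    a \in [:: o2; o3] -> sub_id (I t) (stair (plane_section p a n)) ->
    add_id (I t) (principal ('X_o0 : S)) ('X_o1 ^+ p.+1) ->
    add_id (I t) (principal ('X_o0 : S)) ('X_o1 ^+ p * 'X_a ^+ n) ->
  eq_id (saturation (add_id (I t) (principal ('X_o0 : S))))
    (add_id (mul_id (principal ('X_o1 ^+ p : S)) (stair (line_multiple a n)))
      (principal ('X_o0 : S))).
Proof.
move=> ha ID J1 Ja F; rewrite plane_section_mul //.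
have idI := fam_ideal s m r t.
have idP : is_ideal (principal ('X_o0 : S)) by exact: principal_ideal.
have idJ := add_ideal idI idP.
pose z := if a == o3 then o2 else o3.
have za : (z == a) = false by move: ha; rewrite /z !inE => /orP[]/eqP->.
have z0 : (z == o0) = false by move: ha; rewrite /z !inE => /orP[]/eqP->.
have z1 : (z == o1) = false by move: ha; rewrite /z !inE => /orP[]/eqP->.
have [[idD _] satD] : closed_subscheme (stair (plane_section p a n) : S -> Prop).
  apply: (@stair_closed_subscheme _ _ z); first exact: plane_section_down.
  by move=> mm; rewrite /plane_section !mnmDE !mnm1E za z0 z1 !addn0.
split=> [[d h]|DF].
  apply: satD; exists d => mm /h[x [y [Ix [c ->] ->]]].
  apply: (idealD idD); first exact: ID.
  by apply: (idealM _ idD); apply: stairX; rewrite /plane_section !mnm1E.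
apply: saturation_intro => //; apply: sub_plane_section DF => //.
by apply: (add_idr idI); exists 1; rewrite mul1r.
Qed.

Lemma not_in_plane p : ~ principal ('X_o0 : S) ('X_o1 ^+ p).
Proof.
move=> [c /(congr1 (mcoeff (U_(o1) *+ p)%MM))].
rewrite mpolyXn mcoeffX eqxx mulrC mcoeff_XM mulmnE mnm1E /= => /eqP.
by rewrite oner_eq0.
Qed.

Lemma power_homog p : ('X_o1 ^+ p : S) \is p.-homog.
Proof. by rewrite mpolyXn dhomogX /= mdegMn mdeg1 mul1n. Qed.

Lemma in_Hzyp_fam t z y p a :
    a \in [:: o2; o3] ->
    eq_id (stair (plane_multiple y)) (colon_id (I t) (principal ('X_o0 : S))) ->
    sub_id (I t) (stair (plane_section p a z)) ->
    add_id (I t) (principal ('X_o0 : S)) ('X_o1 ^+ p.+1) ->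
    add_id (I t) (principal ('X_o0 : S)) ('X_o1 ^+ p * 'X_a ^+ z) ->
  in_Hzyp ('X_o0 : S) z y p (I t).
Proof.
move=> ha hY ID J1 Ja; split; [exact: fam_curve | exact: fam_sqr_h |].
exists (stair (line_multiple a z)), (stair (plane_multiple y)), ('X_o1 ^+ p).
split; last by rewrite (eq_idP (power_x_plane p)); apply: has_degree_plane_multiple.
- split.
  + split; first exact: line_multiple_zero_dim.
    by apply: stairX; rewrite /line_multiple !mnm1E.
  + by split; [exists p; exact: power_homog | exact: not_in_plane].
  + exact: saturation_plane_section.
  exact: hY.
- exact: has_length_line_multiple.
exact: has_degree_plane_multiple.
Qed.

Lemma in_Hzyp_fam_neq0 t : t != 0 ->
  in_Hzyp ('X_o0 : S) r (s + 2) (s + m + 2) (I t).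
Proof.
move=> t0; have idJ : is_ideal (add_id (I t) (principal ('X_o0 : S))).
  by apply: add_ideal; [exact: fam_ideal | exact: principal_ideal].
have scaleJ c F : c != 0 -> add_id (I t) (principal ('X_o0 : S)) (c *: F) ->
    add_id (I t) (principal ('X_o0 : S)) F.
  move=> c0 h; rewrite -[F]scale1r -(mulVf c0) -scalerA; exact: idealZ.
apply: (@in_Hzyp_fam _ _ _ _ o3) => //.
- exact: colon_fam_neq0.
- move=> F [_ h0 h1 h2] mm /andP[/eqP m0 /orP[m1|/andP[/eqP m1 m3]]].
    by rewrite (mon_eta mm) m0 -coef_iter_poly h0 // !coef0.
  rewrite (mon_eta mm) m0 m1 -coef_iter_poly; move: (mm o2) (mm o3) m3 => j l lr.
  (* In [eq2] at v^(j+m+r) w^(l+m+1) with l < r, the terms divisible by w^(m+1+r) do not contribute,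
     leaving only this coefficient of b_s. Then [eq1] shows that w^r divides a_(s+m+2). *)
  have b0 : (iter_poly F)`_1`_s`_j`_(l + (m + 1)) = 0.
    have := congr1 (fun q : {poly {poly k}} => q`_(j + (m + r))`_(l + (m + 1))) h2.
    rewrite coef_eq2 !coef0 addnK.
    have -> : (l + (m + 1) < 2 * m + 2 + r)%N by lia.
    have -> : (j + (m + r) < m + r)%N = false by lia.
    have -> : (l + (m + 1) < m + 1 + r)%N by lia.
    by rewrite mulr0 add0r addr0.
  have := congr1 (fun q : {poly {poly k}} => q`_j`_(l + (m + 1))) h1.
  rewrite coef_eq1 !coef0 b0 addnK mulr0 addr0.
  by have -> : (l + (m + 1) < m + 1)%N = false by lia.
(* The element t x^(p+1), with p = s + m + 2, is completed by -h x^(s+1) w^(m+1); scaling by t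
   avoids inverses. *)
- apply: (scaleJ t) => //.
  apply: (@plane_lift _ _ 0 t%:P%:P 0 (- ('X^(m + 1))%:P)).
  + by rewrite iter_polyZ iter_poly_x; apply: nested_monomial1.
  + by rewrite !mulr0 addr0.
  have -> : (2 * m + 2 + r = (m + 1) + (m + 1 + r))%N by lia.
  by rewrite mulr0 addr0 (exprD _ (m + 1)) polyCM; apply: cancel_ring1.
(* The element t^2 x^p w^r is completed by b_s = -t w^(m+1+r), forced by [eq1], and b_(s+1) =
   v^(m+r), which restores [eq2]. *)
apply: (scaleJ (t * t)); first by rewrite mulf_neq0.
have tt : (t * t)%:P%:P = t%:P%:P * t%:P%:P :> {poly {poly k}} by rewrite !polyCM.
apply: (@plane_lift _ _ ((t * t)%:P%:P * ('X^r)%:P) 0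
  (- (t%:P%:P * ('X^(m + 1 + r))%:P)) 'X^(m + r)).
- rewrite iter_polyZ iter_polyM iter_poly_x iter_poly_w; exact: nested_monomial0.
- by rewrite tt (exprD _ (m + 1)) polyCM; apply: cancel_ring2.
by rewrite mulr0 add0r; apply: cancel_ring3.
Qed.

(** At t = 0, [eq1] gives a_p = 0 for p = s + m + 2, and [eq2] reads w^(2m+2+r) a_(p+1) = -v^(m+r)
    b_s, so v^(m+r) divides a_(p+1). Both conditions are attained. *)
Lemma in_Hzyp_fam_eq0 : in_Hzyp ('X_o0 : S) (m + r) (s + 1) (s + m + 3) (I 0).
Proof.
apply: (@in_Hzyp_fam _ _ _ _ o2) => //.
- exact: colon_fam_eq0.
- move=> F [_ h0 h1 h2] mm /andP[/eqP m0 hm].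
  rewrite (mon_eta mm) m0 -coef_iter_poly.
  have [m1|m1] := ltnP (mm o1) (s + m + 2); first by rewrite h0 // !coef0.
  have [->|m1'] := eqVneq (mm o1) (s + m + 2)%N.
    have := congr1 (fun q : {poly {poly k}} => q`_(mm o2)`_(mm o3 + (m + 1))) h1.
    rewrite coef_eq1 !coef0 mul0r addr0 addnK.
    by have -> : (mm o3 + (m + 1) < m + 1)%N = false by lia.
  have [E mr] : mm o1 = (s + m + 2).+1 /\ (mm o2 < m + r)%N.
    by case/orP: hm => [h|/andP[/eqP h hr]]; lia.
  rewrite E.
  have := congr1 (fun q : {poly {poly k}} => q`_(mm o2)`_(mm o3 + (2 * m + 2 + r))) h2.
  rewrite coef_eq2 !coef0 mul0r addr0 addnK mr addr0.
  by have -> : (mm o3 + (2 * m + 2 + r) < 2 * m + 2 + r)%N = false by lia.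
- have -> : (s + m + 3).+1 = (s + m + 4)%N by lia.
  by apply: add_idl; [exact: principal_ideal | exact: fam_power_x].
have -> : (s + m + 3 = (s + m + 2).+1)%N by lia.
apply: (@plane_lift _ _ 0 'X^(m + r) (- ('X^(2 * m + 2 + r))%:P) 0).
- by rewrite iter_polyM iter_poly_x iter_poly_v; apply: nested_monomial2.
- by rewrite !polyC0 mulr0 mul0r addr0.
by rewrite !polyC0 !mul0r addr0 mulrN mulrC subrr.
Qed.

End FamilyTriples.

(** * Linear changes of coordinates *)

Section Pullback.
Variable A : comNzRingType.
Local Notation S := {mpoly A[4]}.
Implicit Types (sg tg : {rmorphism S -> S}) (I J Q : S -> Prop).

(** Mutually inverse graded algebra automorphisms; carrying the inverse along lets each transport
    statement be proved in one direction only. *)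
Definition graded_auto sg tg :=
  [/\ cancel sg tg, cancel tg sg,
      forall c F, sg (c *: F) = c *: sg F, forall c F, tg (c *: F) = c *: tg F &
      (forall d F, F \is d.-homog -> sg F \is d.-homog) /\
      (forall d F, F \is d.-homog -> tg F \is d.-homog)].

Lemma graded_auto_sym sg tg : graded_auto sg tg -> graded_auto tg sg.
Proof. by case=> h1 h2 h3 h4 [h5 h6]; split. Qed.

Definition pull sg I : S -> Prop := fun F => I (sg F).

Lemma pullK sg tg I : graded_auto sg tg -> pull sg (pull tg I) = I.
Proof. by case=> sgK _ _ _ _; apply/funext => F; rewrite /pull sgK. Qed.

Lemma pull_ideal sg I : is_ideal I -> is_ideal (pull sg I).
Proof.
move=> idI; split=> [|F G IF IG|F G IG]; rewrite /pull.
- by rewrite rmorph0; apply: ideal0.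
- by rewrite rmorphD; apply: idealD.
by rewrite rmorphM; apply: idealM.
Qed.

Lemma pull_pihomog sg tg d F : graded_auto sg tg ->
  sg (pihomog mdeg d F) = pihomog mdeg d (sg F).
Proof.
move=> [_ _ _ _ [homog_sg _]].
have -> : sg F = \sum_(e < (msize F).+1) sg (pihomog mdeg e F).
  by rewrite {1}(pihomog_sum_le (leqnSn (msize F))) rmorph_sum.
rewrite [RHS](raddf_sum (pihomog mdeg d)) /=.
have he e : pihomog mdeg d (sg (pihomog mdeg e F)) =
    if d == e then sg (pihomog mdeg e F) else 0.
  case: eqP => [->|/eqP de]; first by rewrite pihomog_dE // homog_sg // pihomogP.
  by rewrite (@pihomog_ne0 _ _ _ e) // 1?eq_sym // homog_sg // pihomogP.
rewrite (eq_bigr (fun e : 'I_(msize F).+1 => if d == e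
  then sg (pihomog mdeg e F) else 0)) => [|e _]; last exact: he.
have [dF|dF] := ltnP d (msize F).+1.
  rewrite (bigD1 (Ordinal dF)) //= eqxx big1 ?addr0 // => e ed.
  by rewrite ifN //; apply: contraNneq ed => E; apply/eqP/val_inj.
rewrite (pihomog_eq0 (ltnW dF)) rmorph0 big1 // => e _.
by rewrite ifN //; apply/eqP => E; have := ltn_ord e; rewrite -E ltnNge dF.
Qed.

Lemma pull_homogeneous sg tg I : graded_auto sg tg ->
  homogeneous I -> homogeneous (pull sg I).
Proof.
move=> H [idI hI]; split; first exact: pull_ideal.
by move=> d F IF; rewrite /pull (pull_pihomog _ _ H); apply: hI.
Qed.

(** Saturation is defined by monomials; passing to all forms of degree n makes it independent of
    coordinates. *)
Lemma saturation_homog I n F G : is_ideal I ->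
  (forall m, mdeg m = n -> I ('X_[m] * F)) -> G \is n.-homog -> I (G * F).
Proof.
move=> idI h /dhomogP Gn; rewrite (mpolyE G) mulr_suml big_seq.
by apply: (ideal_sum _ idI) => m /Gn /h; rewrite -scalerAl; apply: idealZ.
Qed.

Lemma pull_saturation_sub sg tg I F : graded_auto sg tg -> is_ideal I ->
  saturation (pull sg I) F -> saturation I (sg F).
Proof.
move=> H idI [n h]; have [sgK tgK _ _ [_ homog_tg]] := H.
exists n => m mn; rewrite -['X_[m]]tgK -rmorphM.
apply: (saturation_homog (pull_ideal sg idI) h); apply: homog_tg.
by rewrite dhomogX /= mn.
Qed.

Lemma pull_saturation sg tg I : graded_auto sg tg -> is_ideal I ->
  saturation (pull sg I) = pull sg (saturation I).
Proof.
move=> H idI; apply: eq_idP => F; split.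
  exact: pull_saturation_sub H idI.
have H' := graded_auto_sym H; have [sgK _ _ _ _] := H.
rewrite /pull -{1}(pullK I H') => /(pull_saturation_sub H').
by rewrite sgK; apply; apply: pull_ideal.
Qed.

Lemma pull_closed_subscheme sg tg I : graded_auto sg tg ->
  closed_subscheme I -> closed_subscheme (pull sg I).
Proof.
move=> H [hI satI]; split; first exact: pull_homogeneous H hI.
by move=> F; rewrite (pull_saturation H) => [|]; [apply: satI | case: hI].
Qed.

Lemma pull_prime sg I : is_prime I -> is_prime (pull sg I).
Proof.
move=> [idI I1 prI]; split; first exact: pull_ideal.
  by rewrite /pull rmorph1.
by move=> F G; rewrite /pull rmorphM; apply: prI.
Qed.

(** Omitting some variable does not depend on coordinates: if the pulled back ideal contained all
    variables it would contain all linear forms, in particular [tg 'X_i], whence X_i would lie in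
    Q. *)
Lemma pull_is_point sg tg Q : graded_auto sg tg -> is_point Q -> is_point (pull sg Q).
Proof.
move=> H [hQ prQ [i nQi]]; split; [exact: pull_homogeneous H hQ|exact: pull_prime|].
apply: contrapT => no; apply: nQi; have [idQ _ _] := prQ.
have [_ tgK _ _ [_ homog_tg]] := H; rewrite -['X_i]tgK -[tg _]mulr1.
apply: (@saturation_homog (pull sg Q) 1); first exact: pull_ideal.
  move=> m /eqP /mdeg1P[j /eqP->]; rewrite mulr1; apply: contrapT => nj.
  by apply: no; exists j.
by apply: homog_tg; rewrite dhomogX /= mdeg1.
Qed.

Lemma pull_chain_above sg tg n Q : graded_auto sg tg ->
  chain_above Q n -> chain_above (pull sg Q) n.
Proof.
move=> H; have [sgK tgK _ _ _] := H.
elim: n Q => //= n IHn Q [Q' [ptQ' QQ' nQ'Q /IHn h]]; exists (pull sg Q').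
split=> //; [exact: pull_is_point H ptQ' | by move=> F; apply: QQ' |].
by move=> h'; apply: nQ'Q => F; rewrite -[F]tgK; apply: h'.
Qed.

Lemma pull_point_dim sg tg n Q : graded_auto sg tg ->
  point_dim Q n -> point_dim (pull sg Q) n.
Proof.
move=> H [h1 h2]; split; first exact: pull_chain_above H h1.
move=> h; apply: h2; have H' := graded_auto_sym H.
by rewrite -(pullK Q H'); apply: pull_chain_above H' h.
Qed.

Lemma pull_component sg tg I Q : graded_auto sg tg ->
  is_component I Q -> is_component (pull sg I) (pull sg Q).
Proof.
move=> H [ptQ IQ Qmin]; have [sgK tgK _ _ _] := H.
have H' := graded_auto_sym H.
split; [exact: pull_is_point H ptQ|by move=> F; apply: IQ|].
move=> Q' ptQ' IQ' Q'Q F; rewrite -(pullK Q' H); apply: Qmin.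
- exact: pull_is_point H' ptQ'.
- by move=> G IG; apply: IQ'; rewrite /pull tgK.
by move=> G /Q'Q; rewrite /pull tgK.
Qed.

Lemma pull_principal sg tg F : graded_auto sg tg ->
  pull sg (principal F) = principal (tg F).
Proof.
move=> [sgK tgK _ _ _]; apply: eq_idP => G; split=> [[a E]|[a ->]].
  by exists (tg a); rewrite -rmorphM -E sgK.
by exists (sg a); rewrite rmorphM tgK.
Qed.

Lemma pull_colon sg tg I J : graded_auto sg tg ->
  pull sg (colon_id I J) = colon_id (pull sg I) (pull sg J).
Proof.
move=> [sgK tgK _ _ _]; apply: eq_idP => F; split=> h a Ja.
  by rewrite /pull rmorphM; apply: h.
by rewrite -[a]tgK -rmorphM; apply: h; rewrite /pull tgK.
Qed.

Lemma pull_add_id sg tg I J : graded_auto sg tg ->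
  pull sg (add_id I J) = add_id (pull sg I) (pull sg J).
Proof.
move=> [sgK tgK _ _ _]; apply: eq_idP => F; split=> [[a [b [Ia Jb E]]]|[a [b [Ia Jb ->]]]].
  exists (tg a), (tg b); split; rewrite /pull ?tgK //.
  by rewrite -rmorphD -E sgK.
by exists (sg a), (sg b); split; rewrite ?rmorphD.
Qed.

Lemma pull_mul_id sg tg I J : graded_auto sg tg ->
  pull sg (mul_id I J) = mul_id (pull sg I) (pull sg J).
Proof.
move=> [sgK tgK _ _ _]; apply: eq_idP => F; split=> h K idK GK.
  have := h (pull tg K) (pull_ideal tg idK); rewrite /pull sgK; apply.
  move=> _ [a [b [Ia Jb ->]]]; apply: GK; exists (tg a), (tg b).
  by rewrite /pull !tgK rmorphM.
apply: (h (pull sg K) (pull_ideal sg idK)) => _ [a [b [Ia Jb ->]]].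
by apply: GK; exists (sg a), (sg b); rewrite rmorphM.
Qed.

Lemma pull_associated sg tg I Q : graded_auto sg tg ->
  is_associated I Q -> is_associated (pull sg I) (pull sg Q).
Proof.
move=> H [ptQ [f fP]]; split; first exact: pull_is_point H ptQ.
by exists (tg f) => F; rewrite -(pull_principal f H) -(pull_colon _ _ H); apply: fP.
Qed.

Lemma pull_curve sg tg I : graded_auto sg tg -> is_curve I -> is_curve (pull sg I).
Proof.
move=> H [clI I1 dimI embI]; have H' := graded_auto_sym H.
split; first exact: pull_closed_subscheme H clI.
- by rewrite /pull rmorph1.
- move=> Q /(pull_component H'); rewrite (pullK I H') => /dimI.
  by move/(pull_point_dim H); rewrite (pullK Q H).
move=> Q /(pull_associated H'); rewrite (pullK I H') => /embI.
by move/(pull_component H); rewrite (pullK Q H).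
Qed.

Lemma pull_zero_dimensional sg tg I : graded_auto sg tg ->
  zero_dimensional I -> zero_dimensional (pull sg I).
Proof.
move=> H [clI dimI]; have H' := graded_auto_sym H; have [sgK tgK _ _ _] := H.
split=> [|Q ptQ IQ]; first exact: pull_closed_subscheme H clI.
rewrite -(pullK Q H); apply: pull_point_dim H _; apply: dimI.
  exact: pull_is_point H' ptQ.
by move=> F IF; apply: IQ; rewrite /pull tgK.
Qed.

End Pullback.

Section PullbackField.
Variable k : fieldType.
Local Notation S := {mpoly k[4]}.
Variables (sg tg : {rmorphism S -> S}).
Hypothesis H : graded_auto sg tg.
Implicit Types (I J : S -> Prop).

Lemma pull_hilbert_function I n d : hilbert_function I n d ->
  hilbert_function (pull sg I) n d.
Proof.
have [sgK tgK sgZ tgZ [homog_sg homog_tg]] := H.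
move=> [b [bn hb]]; exists (fun i => tg (b i)); split=> [i|F Fn].
  exact: homog_tg.
have E c : sg (F - \sum_i c i *: tg (b i)) = sg F - \sum_i c i *: b i.
  rewrite rmorphB rmorph_sum; congr (_ - _); apply: eq_bigr => i _.
  by rewrite sgZ tgK.
have [c [h1 h2]] := hb (sg F) (homog_sg _ _ Fn).
by exists c; split=> [|c']; rewrite /pull E //; apply: h2.
Qed.

Lemma pull_hilbert_polynomial I P : hilbert_polynomial I P ->
  hilbert_polynomial (pull sg I) P.
Proof.
move=> [N h]; exists N => n /h[d hd E]; exists d => //.
exact: pull_hilbert_function.
Qed.

Lemma pull_in_Hzyp h z y p I : in_Hzyp h z y p I ->
  in_Hzyp (tg h) z y p (pull sg I).
Proof.
have [sgK tgK sgZ tgZ [homog_sg homog_tg]] := H.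
move=> [cI Ih [Z [Y [f [[[zZ Zh] [[d fd] nf] satE YE] lenZ degY degP]]]]].
split; first exact: pull_curve H cI.
  by rewrite /pull rmorphXn /= tgK.
have idZ : is_ideal Z by case: zZ => -[[]].
have idI : is_ideal I by case: cI => -[[]].
exists (pull sg Z), (pull sg Y), (tg f); split.
- split.
  + by split; [exact: pull_zero_dimensional H zZ | rewrite /pull tgK].
  + split; first by exists d; apply: homog_tg.
    by rewrite -(pull_principal h H) /pull tgK.
  + rewrite -!(pull_principal _ H) -(pull_mul_id _ _ H) -!(pull_add_id _ _ H).
    rewrite (pull_saturation H); first by move=> F; apply: satE.
    by apply: add_ideal => //; apply: principal_ideal.
  by rewrite -(pull_principal _ H) -(pull_colon _ _ H) => F; apply: YE.
- exact: pull_hilbert_polynomial.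
- by have [c hc] := degY; exists c; apply: pull_hilbert_polynomial.
rewrite -!(pull_principal _ H) -(pull_add_id _ _ H).
by have [c hc] := degP; exists c; apply: pull_hilbert_polynomial.
Qed.

End PullbackField.

Lemma mpoly_rmorph_ext (A R : comNzRingType) n
    (f g : {rmorphism {mpoly A[n]} -> R}) :
  (forall c, f c%:MP = g c%:MP) -> (forall i, f 'X_i = g 'X_i) -> f =1 g.
Proof.
move=> fgC fgX F; rewrite (mpolyE F) !rmorph_sum; apply: eq_bigr => m _.
rewrite -mul_mpolyC !rmorphM fgC mpolyXE_id !rmorph_prod; congr (_ * _).
by apply: eq_bigr => i _; rewrite !rmorphXn /= fgX.
Qed.

Section LinearSubstitution.
Variable A : comNzRingType.
Local Notation S := {mpoly A[4]}.
Implicit Types (M : 'M[A]_4) (F : S).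

Definition lin_subst M : S -> S :=
  mmap (@mpolyC 4 A) (fun i => \sum_j M i j *: 'X_j).

HB.instance Definition _ M := GRing.RMorphism.on (lin_subst M).

Lemma lin_substZ M c F : lin_subst M (c *: F) = c *: lin_subst M F.
Proof. by rewrite /lin_subst mmapZ mul_mpolyC. Qed.

Lemma lin_substC M c : lin_subst M c%:MP = c%:MP.
Proof. by rewrite /lin_subst mmapC. Qed.

Lemma lin_substX M i : lin_subst M 'X_i = \sum_j M i j *: 'X_j.
Proof. by rewrite /lin_subst mmapX mmap1U. Qed.

(** The order is reversed because the rows of the matrix are the images of the variables. *)
Lemma lin_substM M N F : lin_subst M (lin_subst N F) = lin_subst (N *m M) F.
Proof.
apply: (@mpoly_rmorph_ext _ _ _ (lin_subst M \o lin_subst N : {rmorphism S -> S})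
  (lin_subst (N *m M))) => [c|i] /=; first by rewrite !lin_substC.
rewrite !lin_substX rmorph_sum /=.
under eq_bigr do rewrite lin_substZ lin_substX scaler_sumr.
rewrite exchange_big; apply: eq_bigr => j _ /=.
by rewrite mxE scaler_suml; apply: eq_bigr => l _; rewrite scalerA.
Qed.

Lemma lin_subst1 F : lin_subst 1%:M F = F.
Proof.
apply: (@mpoly_rmorph_ext _ _ _ (lin_subst 1%:M) (idfun : {rmorphism S -> S})).
  by move=> c; rewrite /= lin_substC.
move=> i; rewrite /= lin_substX (bigD1 i) //= mxE eqxx scale1r big1 ?addr0 //.
by move=> j ji; rewrite mxE eq_sym (negPf ji) scale0r.
Qed.

Lemma lin_subst_homog M d F : F \is d.-homog -> lin_subst M F \is d.-homog.
Proof.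
move=> /dhomogP Fd; rewrite (mpolyE F) rmorph_sum /= big_seq.
apply: rpred_sum => m /Fd /= <-; rewrite lin_substZ; apply: rpredZ.
rewrite mpolyXE_id rmorph_prod /= mdegE.
elim: (index_enum _) => [|i e IHe]; first by rewrite !big_nil dhomog1.
rewrite !big_cons; apply: dhomogM => //; rewrite rmorphXn /= lin_substX.
rewrite -[X in X.-homog]mul1n; apply: dhomogMn; apply: rpred_sum => j _.
by apply: rpredZ; rewrite dhomogX /= mdeg1.
Qed.

Lemma lin_subst_auto M N : M *m N = 1%:M -> N *m M = 1%:M ->
  graded_auto (lin_subst M : {rmorphism S -> S}) (lin_subst N).
Proof.
move=> MN NM; split=> [F|F|||].
- by rewrite /= lin_substM MN lin_subst1.
- by rewrite /= lin_substM NM lin_subst1.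
- exact: lin_substZ.
- exact: lin_substZ.
by split; exact: lin_subst_homog.
Qed.

End LinearSubstitution.

Lemma map_lin_subst (A R : comNzRingType) (t : {rmorphism A -> R}) M F :
  map_mpoly t (lin_subst M F) = lin_subst (map_mx t M) (map_mpoly t F).
Proof.
apply: (@mpoly_rmorph_ext _ _ _
  (map_mpoly t \o lin_subst M : {rmorphism {mpoly A[4]} -> {mpoly R[4]}})
  (lin_subst (map_mx t M) \o map_mpoly t : {rmorphism {mpoly A[4]} -> {mpoly R[4]}})).
  by move=> c /=; rewrite lin_substC !map_mpolyC lin_substC.
move=> i /=; rewrite map_mpolyX !lin_substX rmorph_sum /=.
by apply: eq_bigr => j _; rewrite map_mpolyZ map_mpolyX mxE.
Qed.

Lemma linear_form_coordinate (k : fieldType) (h : {mpoly k[4]}) :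
  h \is 1.-homog -> h != 0 ->
  exists2 N : 'M[k]_4, N \in unitmx & lin_subst N 'X_o0 = h.
Proof.
move=> /dhomogP h1 h0; pose u := \row_j h@_U_(j).
have hE : h = \sum_j u 0 j *: 'X_j.
  apply/mpolyP => m; rewrite raddf_sum /=.
  have [/mdeg1P[j /eqP->]|m1] := boolP (mdeg m == 1%N).
    rewrite (bigD1 j) //= mcoeffZ mcoeffX eqxx mulr1 mxE big1 ?addr0 // => l lj.
    by rewrite mcoeffZ mcoeffX eq_mnm1 (negPf lj) mulr0.
  rewrite big1 => [|j _].
    by apply/memN_msupp_eq0; apply: contra m1 => /h1 /= ->.
  rewrite mcoeffZ mcoeffX; case: eqP => [E|_]; rewrite ?mulr0 //.
  by rewrite -E mdeg1 in m1.
have u0 : u != 0.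
  apply: contraNneq h0 => u0; rewrite hE big1 // => j _.
  by rewrite u0 mxE scale0r.
(* f sends the first basis row to the coefficient row u of h. Both rows have rank one, so some
   invertible matrix agrees with f on the first basis row. *)
pose U : 'rV[k]_4 := delta_mx 0 o0; pose f : 'M[k]_4 := \matrix_(i < 4) u.
have Uf : U *m f = u by rewrite /U -rowE rowK.
have [|N Nunit NE] := @complete_unitmx _ _ _ U f.
  by rewrite Uf rank_rV u0 mxrank_delta.
exists N => //; rewrite lin_substX hE; apply: eq_bigr => j _; congr (_ *: _).
by rewrite -Uf NE /U -rowE mxE.
Qed.

Lemma pull_graded_dual_basis (A : comNzRingType)
    (sg tg : {rmorphism {mpoly A[4]} -> {mpoly A[4]}}) I d :
  graded_auto sg tg -> graded_dual_basis I d -> graded_dual_basis (pull sg I) d.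
Proof.
move=> [sgK tgK sgZ tgZ [homog_sg _]] [r [e [la [la_lin la0 laP]]]].
exists r, (fun i => tg (e i)), (fun i F => la i (sg F)); split.
- by move=> i a x y; rewrite rmorphD sgZ la_lin.
- by move=> i x; apply: la0.
move=> x xd; rewrite /pull rmorphB rmorph_sum.
rewrite (eq_bigr (fun i : 'I_r => la i (sg x) *: e i)) => [|i _].
  exact/laP/homog_sg.
by rewrite sgZ tgK.
Qed.

(** The coordinate change has coefficients in k, so it is constant along the family and commutes
    with specialization. *)
Lemma fibre_pull (k : fieldType) (A : idomainType) (phi : {rmorphism k -> A})
    (t : {rmorphism A -> k}) (M N : 'M[k]_4) (I : {mpoly A[4]} -> Prop) :
    closed_point phi t -> is_ideal I -> M *m N = 1%:M -> N *m M = 1%:M ->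
  fibre (pull (lin_subst (map_mx phi M)) I) t = pull (lin_subst M) (fibre I t).
Proof.
move=> phiK idI MN NM.
have tphi (X : 'M[k]_4) : map_mx t (map_mx phi X) = X.
  by apply/matrixP => i j; rewrite !mxE; apply: phiK.
have H := lin_subst_auto MN NM.
have HA : graded_auto (lin_subst (map_mx phi M) : {rmorphism {mpoly A[4]} -> {mpoly A[4]}})
    (lin_subst (map_mx phi N)).
  by apply: lin_subst_auto; rewrite -map_mxM ?MN ?NM map_mx1.
have [sgK tgK _ _ _] := H; have [sgAK tgAK _ _ _] := HA.
rewrite /fibre -(pull_saturation H); last exact: fibre_image_ideal phiK idI.
congr saturation; apply: eq_idP => F; split=> [[g Ig ->]|[g Ig E]].
  exists (lin_subst (map_mx phi M) g); first exact: Ig.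
  by rewrite map_lin_subst tphi; reflexivity.
exists (lin_subst (map_mx phi N) g); first by rewrite /pull tgAK.
by rewrite map_lin_subst tphi -E /= sgK.
Qed.

(** * The specialization in an arbitrary plane *)

Theorem proposition8p2 (k : closedFieldType) (h : {mpoly k[4]})
    (h_linear : h \is 1.-homog) (h_neq0 : h != 0)
    (y p r : nat) (hy : (2 <= y)%N) (hp : (y <= p)%N) :
  specializes h r y p (r + p - y)%N (y - 1)%N (p + 1)%N.
Proof.
have [N Nunit Nh] := linear_form_coordinate h_linear h_neq0.
pose M := invmx N; have MN : M *m N = 1%:M by exact: mulVmx.
have NM : N *m M = 1%:M by exact: mulmxV.
pose phi : {rmorphism k -> {poly k}} := polyC.
have HA : graded_auto
    (lin_subst (map_mx phi M) : {rmorphism {mpoly {poly k}[4]} -> {mpoly {poly k}[4]}})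
    (lin_subst (map_mx phi N)).
  by apply: lin_subst_auto; rewrite -map_mxM ?MN ?NM map_mx1.
have H := lin_subst_auto MN NM.
(* Both subtractions are exact by the hypotheses on y and p. The deformation parameter is the
   coordinate of the affine line. *)
pose s := (y - 2)%N; pose m := (p - y)%N.
pose I0 : {mpoly {poly k}[4]} -> Prop := fam s m r 'X.
have idI0 : is_ideal I0 by exact: fam_ideal.
have fibreE (t : {rmorphism {poly k} -> k}) : closed_point phi t ->
    fibre (pull (lin_subst (map_mx phi M)) I0) t =
    pull (lin_subst M) (fam s m r (t 'X)).
  move=> tK; rewrite (fibre_pull tK idI0 MN NM); congr pull.
  exact: fam_fibre tK.
pose t0 : {rmorphism {poly k} -> k} := horner_eval 0.
have t0K : closed_point phi t0 by move=> c; rewrite /t0 /= /horner_eval hornerC.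
have t0X : t0 'X = 0 by rewrite /t0 /= /horner_eval hornerX.
exists {poly k}, phi, t0, (pull (lin_subst (map_mx phi M)) I0); split.
- by split=> //; exact: affine_line_nonsingular.
- split; last first.
    rewrite /pull rmorphXn /= -map_lin_subst -Nh lin_substM NM lin_subst1.
    by rewrite map_mpolyX; apply: fam_sqr_h.
  have clI0 := fam_closed_subscheme s m r ('X : {poly k}).
  split; first exact: pull_closed_subscheme HA clI0.
  move=> i; apply: flat_chart => [|d].
    by apply: pull_homogeneous HA _; case: clI0.
  apply: pull_graded_dual_basis HA _; exact: fam_dual_basis.
- move=> t tK tt0; rewrite (fibreE t tK) -Nh; apply: (pull_in_Hzyp H).
  have -> : y = (s + 2)%N by rewrite /s; lia.
  have -> : p = (s + m + 2)%N by rewrite /s /m; lia.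
  (* A closed point of the line is the identity on constants, hence is determined by its value at
     the coordinate; the value 0 occurs only at [t0]. *)
  apply: in_Hzyp_fam_neq0; apply: contra_notN tt0 => /eqP tX f.
  elim/poly_ind: f => [|f c IHf]; first by rewrite !rmorph0.
  by rewrite !rmorphD !rmorphM /= IHf tX t0X; congr (_ + _); rewrite [LHS]tK -[LHS]t0K.
rewrite (fibreE t0 t0K) t0X -Nh; apply: (pull_in_Hzyp H).
have -> : (r + p - y = m + r)%N by rewrite /m; lia.
have -> : (y - 1 = s + 1)%N by rewrite /s; lia.
have -> : (p + 1 = s + m + 3)%N by rewrite /s /m; lia.
exact: in_Hzyp_fam_eq0.
Qed.
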